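(* Let $N\ge0$, $\vec{\mathbf a}_N=(a(0),\dots,a(N))\in\mathbb C^{N+1}$, $\varepsilon_1>0$, let $f_1$ be a given bounded spectral density, and $$D_{2\varepsilon_1}=\left\{f:\frac1{2\pi}\int_{-\pi}^\pi|f(\lambda)-f_1(\lambda)|^2d\lambda\le\varepsilon_1\right\}.$$ Let $f_0\in D_{2\varepsilon_1}$, let $f_0^{-1}$ be integrable, put $C_N^0(e^{i\lambda})=\sum_{j=0}^N((B_N^0)^{-1}\vec{\mathbf a}_N)_je^{ij\lambda}$, and let the function $$h(f_0)=\sum_{j=0}^Na(j)e^{ij\lambda}-C_N^0(e^{i\lambda})f_0^{-1}(\lambda)$$ be bounded. Suppose that for some constant $\alpha_1$ $$\left|C_N^0(e^{i\lambda})\right|^2=(f_0(\lambda))^2(f_0(\lambda)-f_1(\lambda))\alpha_1$$ and that $f_0$ determines a solution to the optimization problem $$\max_{f\in D_{2\varepsilon_1}}\langle B_N^{-1}\vec{\mathbf a}_N,\vec{\mathbf a}_N\rangle=\langle(B_N^0)^{-1}\vec{\mathbf a}_N,\vec{\mathbf a}_N\rangle .$$ Then $f_0$ is the least favourable spectral density in $D_{2\varepsilon_1}$ for the optimal linear estimate of $A_N\xi=\sum_{j=0}^Na(j)\xi(j)$ based on observations of $\xi(j)$ at $j\in\mathbb Z\setminus\{0,1,\dots,N\}$, and $h^0=h(f_0)$ is the minimax-robust spectral characteristic of the optimal linear estimate of $A_N\xi$.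
   Context: $\xi$ is a zero mean wide sense stationary sequence with spectral density $f$: $E\xi(j+k)\overline{\xi(j)}=\frac1{2\pi}\int_{-\pi}^\pi e^{ik\lambda}f(\lambda)d\lambda$. $B_N$ is the $(N+1)\times(N+1)$ matrix with entries $\frac1{2\pi}\int_{-\pi}^\pi f^{-1}(\lambda)e^{-i(k-j)\lambda}d\lambda$, $k,j=0,\dots,N$ (densities $f$ being understood to satisfy the minimality condition $\int f^{-1}d\lambda<\infty$ wherever $B_N^{-1}$ is used), and $B_N^0$ is this matrix for $f_0$. $\langle x,y\rangle=\sum_{k=0}^Nx_k\overline{y_k}$. $L_2^N(f)$ is the closed span of $\{e^{ij\lambda}:j\in\mathbb Z\setminus\{0,\dots,N\}\}$ in $L_2(f)$; for $h\in L_2^N(f)$, $\Delta(h;f)=\frac1{2\pi}\int_{-\pi}^\pi|\sum_{j=0}^Na(j)e^{ij\lambda}-h|^2f\,d\lambda$, and $h(f)$ denotes its minimizer. For a class $D$ of densities, $f_0\in D$ is least favourable if $\Delta(h(f_0);f_0)=\max_{f\in D}\Delta(h(f);f)$; $h^0$ is minimax-robust if $h^0\in H_D=\bigcap_{f\in D}L_2^N(f)$ and $\min_{h\in H_D}\max_{f\in D}\Delta(h;f)=\sup_{f\in D}\Delta(h^0;f)$. *)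

(* Defs.v *)
From HB Require Import structures.
From mathcomp Require Import all_boot all_order all_algebra.
From mathcomp Require Import all_classical all_reals all_analysis.
From mathcomp Require Export complex.
Set Implicit Arguments.
Unset Strict Implicit.
Unset Printing Implicit Defensive.
Import Order.TTheory GRing.Theory Num.Theory.
Import numFieldNormedType.Exports.
Import ComplexField.Normc.

Local Open Scope classical_set_scope.
Local Open Scope ring_scope.
Local Open Scope complex_scope.

Section Interpolation.
Context {R : realType}.

Local Notation mu := (@lebesgue_measure R).

Definition circle : set R := `[- pi, pi]%classic.

(* Functions on the circle are only determined up to a null set, so pointwise
   relations between them are required almost everywhere. *)
Definition ae_circle (P : R -> Prop) : Prop :=
  {ae mu, forall l, circle l -> P l}.

(* e^{ikl} *)
Definition cexp (k : int) (l : R) : R[i] :=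
  cos (k%:~R * l) +i* sin (k%:~R * l).

Definition cmeasurable (g : R -> R[i]) : Prop :=
  measurable_fun circle (fun l => complex.Re (g l)) /\
  measurable_fun circle (fun l => complex.Im (g l)).

Definition cmean (g : R -> R[i]) : R[i] :=
  ((2 * pi)^-1 * \int[mu]_(l in circle) complex.Re (g l)) +i*
  ((2 * pi)^-1 * \int[mu]_(l in circle) complex.Im (g l)).

Definition emean (g : R -> \bar R) : \bar R :=
  (((2 * pi)^-1)%:E * \int[mu]_(l in circle) g l)%E.

Definition spectral_density (f : R -> R) : Prop :=
  (forall l, circle l -> 0 <= f l) /\
  mu.-integrable circle (EFin \o f).

(* The inverse is taken in the extended reals, where 0^-1 = +oo: integrability
   of f^-1 forces f > 0 almost everywhere. *)
Definition minimal_density (f : R -> R) : Prop :=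
  (\int[mu]_(l in circle) ((f l)%:E^-1) < +oo)%E.

Definition sqnorm (f : R -> R) (h : R -> R[i]) : \bar R :=
  emean (fun l => (normc (h l) ^+ 2 * f l)%:E).

(* The linear span of the e^{ijl}, j in Z \ {0, ..., N}. *)
Definition observed_span (N : nat) : set (R -> R[i]) :=
  [set p | exists (s : seq int) (c : int -> R[i]),
     all (fun j : int => ~~ (0 <= j <= N%:Z)) s /\
     p = (fun l => \sum_(j <- s) c j * cexp j l)].

Definition L2obs (N : nat) (f : R -> R) : set (R -> R[i]) :=
  [set h | [/\ cmeasurable h, (sqnorm f h < +oo)%E &
     forall e : R, 0 < e -> exists2 p, observed_span N p &
       (sqnorm f (fun l => h l - p l)%R < e%:E)%E]].

Definition trigpoly (N : nat) (c : 'cV[R[i]]_N.+1) (l : R) : R[i] :=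
  \sum_(j < N.+1) c j 0 * cexp j%:Z l.

Definition Delta (N : nat) (a : 'cV[R[i]]_N.+1) (h : R -> R[i]) (f : R -> R) :
    \bar R :=
  sqnorm f (fun l => trigpoly a l - h l).

(* h is (a version of) h(f).  The minimizer exists for every density by the
   projection theorem in L_2(f), and is unique up to f-null sets. *)
Definition spectral_characteristic (N : nat) (a : 'cV[R[i]]_N.+1)
    (f : R -> R) (h : R -> R[i]) : Prop :=
  L2obs N f h /\ forall g, L2obs N f g -> (Delta a h f <= Delta a g f)%E.

Definition is_max {d : Order.disp_t} {T : porderType d} (S : set T) (v : T) :
  Prop := S v /\ ubound S v.

Definition is_min {d : Order.disp_t} {T : porderType d} (S : set T) (v : T) :
  Prop := S v /\ lbound S v.

Definition least_favourable (N : nat) (a : 'cV[R[i]]_N.+1)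
    (D : set (R -> R)) (f0 : R -> R) : Prop :=
  D f0 /\
  exists2 h0, spectral_characteristic a f0 h0 &
    is_max [set v | exists f h,
              [/\ D f, spectral_characteristic a f h & v = Delta a h f]]
           (Delta a h0 f0).

Definition H_class (N : nat) (D : set (R -> R)) : set (R -> R[i]) :=
  [set h | forall f, D f -> L2obs N f h].

Definition max_error (N : nat) (a : 'cV[R[i]]_N.+1) (D : set (R -> R))
    (h : R -> R[i]) : \bar R :=
  ereal_sup [set Delta a h f | f in D].

Definition minimax_robust (N : nat) (a : 'cV[R[i]]_N.+1)
    (D : set (R -> R)) (h0 : R -> R[i]) : Prop :=
  H_class N D h0 /\
  is_min [set max_error a D h | h in H_class N D] (max_error a D h0).

Definition Bmx (N : nat) (f : R -> R) : 'M[R[i]]_N.+1 :=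
  \matrix_(k, j) cmean (fun l => ((f l)^-1)%:C * cexp (- (k%:Z - j%:Z)) l).

Definition cdot (N : nat) (x y : 'cV[R[i]]_N.+1) : R[i] :=
  \sum_k x k 0 * (y k 0)^*.

Definition quad_error (N : nat) (a : 'cV[R[i]]_N.+1) (f : R -> R) : R[i] :=
  cdot (invmx (Bmx N f) *m a) a.

Definition C_N (N : nat) (a : 'cV[R[i]]_N.+1) (f : R -> R) : R -> R[i] :=
  trigpoly (invmx (Bmx N f) *m a).

Definition h_formula (N : nat) (a : 'cV[R[i]]_N.+1) (f : R -> R) (l : R) :
    R[i] :=
  trigpoly a l - C_N a f l * ((f l)^-1)%:C.

Definition D2 (f1 : R -> R) (eps : R) : set (R -> R) :=
  [set f | spectral_density f /\
     (emean (fun l => (`|f l - f1 l| ^+ 2)%:E) <= eps%:E)%E].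

End Interpolation.

(* Main.v *)
Require Import Defs.
From mathcomp Require Import all_boot all_order all_algebra.
From mathcomp Require Import all_classical all_reals all_analysis complex.
From mathcomp Require Import measurable_realfun ring lra.
Import Order.TTheory GRing.Theory Num.Theory.
Import numFieldNormedType.Exports.
Import ComplexField.Normc.
Set Implicit Arguments.
Unset Strict Implicit.
Unset Printing Implicit Defensive.
Local Open Scope classical_set_scope.
Local Open Scope ring_scope.
Local Open Scope complex_scope.

(* Write A for the trigonometric polynomial of the vector a.  The coefficients of
   C = C_N are chosen so that h0 = A - C / f0 has vanishing Fourier coefficients
   at 0, ..., N.  As h0 is bounded, Fejer means of continuous approximations of
   h0, corrected so that these coefficients still vanish, converge to h0 in L_2(f)
   for every square integrable f, in particular for every f in the ball; so h0 is
   admissible for all of them.  Orthogonality of C to the observed span makes h0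
   optimal for f0.

   Everything else follows from the saddle point inequality
   Delta(h0; f) <= Delta(h0; f0).  By the equation for |C|^2 one has
   Delta(h0; f) = alpha1 * mean ((f0 - f1) f).  The minimal error is homogeneous
   in the density, so by maximality every dilation (1 + t) f0, t > 0, leaves the
   ball (unless C = 0); letting t -> 0 gives mean (f0 - f1)^2 = eps1 and
   mean ((f0 - f1) f0) >= 0, hence alpha1 > 0, and then the inequality is
   2 (f0 - f1) (f - f0) <= (f - f1)^2 - (f0 - f1)^2 integrated. *)

(** * Means over the circle *)

Section RealMeans.
Context {R : realType}.
Local Notation mu := (@lebesgue_measure R).
Implicit Types (f g : R -> R).

(** The hypotheses leave the sign of [alpha1] open, while the error of h0 under f is [alpha1] times
    a linear functional of f; f0 maximizes it over the ball once that factor is nonnegative, and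
    maximality of f0 is what supplies the sign. Dilations are good test densities because they keep
    the inverse integrable and scale the minimal error exactly, so the inverse of B_N is never
    differentiated. Members of the ball may lack an integrable inverse, so no formula for h(f) is at
    hand; every comparison passes through the error of the fixed h0, in which only the matrix of f0
    occurs. They may also be unbounded, so approximating h0 in the unweighted L_2 is not enough. The
    approximants share a uniform bound fixed before the accuracy; a small mean error is then traded
    against the mean of f^2, finite because f - f1 is square integrable and f1 bounded. Fejer means
    serve because they keep the bound and multiply each Fourier coefficient by a number, so a
    vanishing one stays zero. *)

Definition circle_integrable f : Prop := mu.-integrable circle (EFin \o f).

Let ae_mu_filter : Filter (nbhs (almost_everywhere mu)).
Proof. exact: ae_filter_ringOfSetsType. Qed.

Lemma ae_circleW (P : R -> Prop) : (forall l, circle l -> P l) -> ae_circle P.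
Proof. by move=> h; apply: (@aeW _ _ _ mu). Qed.

Lemma ae_circleS (P Q : R -> Prop) : (forall l, circle l -> P l -> Q l) ->
  ae_circle P -> ae_circle Q.
Proof. by move=> PQ; apply: (@filterS _ _ ae_mu_filter) => l h cl; apply: PQ (h cl). Qed.

Lemma ae_circleS2 (P Q S : R -> Prop) :
  (forall l, circle l -> P l -> Q l -> S l) ->
  ae_circle P -> ae_circle Q -> ae_circle S.
Proof.
by move=> PQ; apply: (@filterS2 _ _ ae_mu_filter) => l h1 h2 cl; apply: PQ (h1 cl) (h2 cl).
Qed.

Definition rmean f : R := (2 * pi)^-1 * \int[mu]_(l in circle) f l.

Lemma measurable_circle : measurable (circle : set R).
Proof. exact: measurable_itv. Qed.
Hint Resolve measurable_circle : core.

Lemma mu_circle : mu (circle : set R) = (2 * pi)%:E.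
Proof.
rewrite lebesgue_measure_itv /= lte_fin gtrN ?pi_gt0 // -EFinD opprK.
by congr EFin; ring.
Qed.

Lemma mu_circle_lty : (mu (circle : set R) < +oo)%E.
Proof. by rewrite mu_circle ltry. Qed.

Lemma inv2pi_gt0 : 0 < (2 * pi : R)^-1.
Proof. by rewrite invr_gt0 mulr_gt0 ?pi_gt0. Qed.

Lemma circle_integrable_measurable f :
  circle_integrable f -> measurable_fun circle f.
Proof. by move=> /integrableP[/measurable_EFinP]. Qed.

Lemma circle_integrable_bounded f M : measurable_fun circle f ->
  (forall l, circle l -> `|f l| <= M) -> circle_integrable f.
Proof.
move=> mf fM; apply: measurable_bounded_integrable => //.
  exact: mu_circle_lty.
exists M; split; first exact: num_real.
by move=> x Mx l cl; apply: le_trans (fM l cl) _; exact: ltW.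
Qed.

Lemma circle_integrable_cst c : circle_integrable (fun=> c).
Proof. exact: (@circle_integrable_bounded _ `|c|). Qed.

Lemma circle_integrableD f g : circle_integrable f -> circle_integrable g ->
  circle_integrable (fun l => f l + g l).
Proof. by move=> hf hg; exact: (@integrableD _ _ _ mu _ measurable_circle _ _ hf hg). Qed.

Lemma circle_integrableB f g : circle_integrable f -> circle_integrable g ->
  circle_integrable (fun l => f l - g l).
Proof. by move=> hf hg; exact: (@integrableB _ _ _ mu _ measurable_circle _ _ hf hg). Qed.

Lemma circle_integrableZ c f : circle_integrable f ->
  circle_integrable (fun l => c * f l).
Proof. by move=> hf; exact: (@integrableZl _ _ _ mu _ measurable_circle c _ hf). Qed.

Lemma circle_integrable_norm f : circle_integrable f ->
  circle_integrable (fun l => `|f l|).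
Proof. exact: integrable_norm. Qed.

Lemma circle_integrable_ae f g : measurable_fun circle f ->
  circle_integrable g -> ae_circle (fun l => `|f l| <= g l) ->
  circle_integrable f.
Proof.
move=> mf /integrableP[mg lg] fg; apply/integrableP; split.
  exact/measurable_EFinP.
apply: le_lt_trans lg; apply: ae_ge0_le_integral => //.
- by apply: measurableT_comp => //; exact/measurable_EFinP.
- exact: measurableT_comp.
- apply: ae_circleS fg => l cl h; rewrite /= lee_fin.
  exact: le_trans h (ler_norm _).
Qed.

Lemma circle_integrable_le f g : measurable_fun circle f ->
  circle_integrable g -> (forall l, circle l -> `|f l| <= g l) ->
  circle_integrable f.
Proof. by move=> mf ig fg; exact/(circle_integrable_ae mf ig)/ae_circleW. Qed.

Lemma eq_circle_integrable f g : f =1 g ->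
  circle_integrable f -> circle_integrable g.
Proof. by move=> /funext ->. Qed.

Lemma rmeanD f g : circle_integrable f -> circle_integrable g ->
  rmean (fun l => f l + g l) = rmean f + rmean g.
Proof. by move=> hf hg; rewrite /rmean RintegralD // mulrDr. Qed.

Lemma rmeanB f g : circle_integrable f -> circle_integrable g ->
  rmean (fun l => f l - g l) = rmean f - rmean g.
Proof. by move=> hf hg; rewrite /rmean RintegralB // mulrBr. Qed.

Lemma rmeanZ c f : circle_integrable f ->
  rmean (fun l => c * f l) = c * rmean f.
Proof. by move=> hf; rewrite /rmean RintegralZl // mulrCA. Qed.

Lemma rmean_cst c : rmean (fun=> c) = c.
Proof.
rewrite /rmean Rintegral_cst // [X in fine X]mu_circle /= mulrCA mulVf ?mulr1 //.
by rewrite mulf_neq0 // gt_eqF ?pi_gt0.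
Qed.

Lemma rmean_ge0 f : (forall l, circle l -> 0 <= f l) -> 0 <= rmean f.
Proof.
move=> f0; apply: mulr_ge0; first exact/ltW/inv2pi_gt0.
exact: Rintegral_ge0.
Qed.

Lemma eq_rmean f g : f =1 g -> rmean f = rmean g.
Proof. by move=> /funext ->. Qed.

Lemma eq_rmean_ae f g : measurable_fun circle f -> measurable_fun circle g ->
  ae_circle (fun l => f l = g l) -> rmean f = rmean g.
Proof.
move=> mf mg fg; congr (_ * fine _).
apply: ae_eq_integral => //; [exact/measurable_EFinP..|].
by apply: ae_circleS fg => l _ /= ->.
Qed.

Lemma le_rmean f g : circle_integrable f -> circle_integrable g ->
  (forall l, circle l -> f l <= g l) -> rmean f <= rmean g.
Proof.
move=> hf hg fg; rewrite ler_pM2l ?inv2pi_gt0 //; exact: le_Rintegral.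
Qed.

Lemma le_rmean_ae f g : circle_integrable f -> circle_integrable g ->
  ae_circle (fun l => f l <= g l) -> rmean f <= rmean g.
Proof.
move=> hf hg fg; rewrite -subr_ge0 -rmeanB //.
have hgf := circle_integrableB hg hf.
(* The difference agrees almost everywhere with its absolute value, which is nonnegative
   everywhere. *)
rewrite (@eq_rmean_ae _ (fun l => `|g l - f l|)); first exact: rmean_ge0.
- exact: circle_integrable_measurable.
- by apply: circle_integrable_measurable; exact: circle_integrable_norm.
- by apply: ae_circleS fg => l cl h; rewrite ger0_norm // subr_ge0.
Qed.

Lemma ler_norm_rmean f : circle_integrable f ->
  `|rmean f| <= rmean (fun l => `|f l|).
Proof.
move=> hf; rewrite normrM gtr0_norm ?inv2pi_gt0 // ler_pM2l ?inv2pi_gt0 //.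
exact: le_normr_Rintegral.
Qed.

Lemma rmean_eq0 f : circle_integrable f -> (forall l, circle l -> 0 <= f l) ->
  rmean f = 0 -> ae_circle (fun l => f l = 0).
Proof.
move=> hf f0 /eqP; rewrite mulf_eq0 gt_eqF ?inv2pi_gt0 //= => /eqP h.
have mf := circle_integrable_measurable hf.
have int0 :
    (\int[mu]_(l in circle) `|(f l)%:E| = 0)%E.
  transitivity (\int[mu]_(l in circle) (f l)%:E)%E.
    by apply: eq_integral => l /set_mem cl; rewrite /= ger0_norm // f0.
  rewrite -[LHS]fineK; last exact: integrable_fin_num.
  by congr EFin.
have mEf : measurable_fun circle (EFin \o f) by exact/measurable_EFinP.
have := (ae_eq_integral_abs mu measurable_circle mEf).1 int0.
by apply: ae_circleS => l _ [].
Qed.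

Lemma emean_rmean f : circle_integrable f ->
  emean (fun l => (f l)%:E) = (rmean f)%:E.
Proof.
move=> hf; rewrite /emean /rmean EFinM; congr (_ * _)%E.
by rewrite /Rintegral fineK //; exact: integrable_fin_num.
Qed.

Lemma emean_lty f : measurable_fun circle f ->
  (forall l, circle l -> 0 <= f l) ->
  (emean (fun l => (f l)%:E) < +oo)%E -> circle_integrable f.
Proof.
move=> mf f0 h; apply/integrableP; split; first exact/measurable_EFinP.
have -> : (\int[mu]_(l in circle) `|(EFin \o f) l| =
    \int[mu]_(l in circle) (f l)%:E)%E.
  by apply: eq_integral => l /set_mem cl; rewrite /= ger0_norm // f0.
have i0 : (0 <= \int[mu]_(l in circle) (f l)%:E)%E.
  by apply: integral_ge0 => l cl; rewrite lee_fin f0.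
rewrite ltey; apply: contraTneq h => /= h.
by rewrite /emean h gt0_muley ?ltxx // lte_fin inv2pi_gt0.
Qed.

End RealMeans.

(** * Complex means and orthogonality of the exponentials *)

Section ComplexMeans.
Context {R : realType}.
Local Notation mu := (@lebesgue_measure R).
Local Notation Re := (@complex.Re R).
Local Notation Im := (@complex.Im R).
Implicit Types (g h : R -> R[i]) (z : R[i]) (w : R -> R).

(** Dominates the modulus, is submultiplicative, and splits into real and imaginary parts, so that
    estimates of complex means reduce to real ones without square roots. *)
Definition norm1 z : R := `|Re z| + `|Im z|.

Lemma norm1_ge0 z : 0 <= norm1 z.
Proof. by rewrite addr_ge0. Qed.

Lemma complex_ReD z z' : Re (z + z') = Re z + Re z'.
Proof. by case: z z' => [? ?] [? ?]. Qed.

Lemma complex_ImD z z' : Im (z + z') = Im z + Im z'.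
Proof. by case: z z' => [? ?] [? ?]. Qed.

Lemma complex_ReN z : Re (- z) = - Re z.
Proof. by case: z. Qed.

Lemma complex_ImN z : Im (- z) = - Im z.
Proof. by case: z. Qed.

Lemma complex_ReM z z' : Re (z * z') = Re z * Re z' - Im z * Im z'.
Proof. by case: z z' => [? ?] [? ?]. Qed.

Lemma complex_ImM z z' : Im (z * z') = Re z * Im z' + Im z * Re z'.
Proof. by case: z z' => [? ?] [? ?]. Qed.

Lemma complex_ReJ z : Re z^* = Re z.
Proof. by case: z. Qed.

Lemma complex_ImJ z : Im z^* = - Im z.
Proof. by case: z. Qed.

Lemma complex_eqP z z' : Re z = Re z' -> Im z = Im z' -> z = z'.
Proof. by case: z z' => [? ?] [? ?] /= -> ->. Qed.

Lemma normc_sqr z : normc z ^+ 2 = Re z ^+ 2 + Im z ^+ 2.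
Proof. by case: z => a b /=; rewrite sqr_sqrtr // addr_ge0 ?sqr_ge0. Qed.

Lemma normc_ge0 z : 0 <= normc z.
Proof. by case: z => a b; exact: sqrtr_ge0. Qed.

Lemma normc_sqrJ z : (normc z ^+ 2)%:C = z * z^*.
Proof.
by apply: complex_eqP; rewrite ?complex_ReM ?complex_ImM complex_ReJ complex_ImJ /= ?normc_sqr; ring.
Qed.

Lemma ler_Re_normc z : `|Re z| <= normc z.
Proof.
rewrite -(@ler_pXn2r _ 2) ?nnegrE ?normc_ge0 // normc_sqr real_normK ?num_real //.
by rewrite lerDl sqr_ge0.
Qed.

Lemma ler_Im_normc z : `|Im z| <= normc z.
Proof.
rewrite -(@ler_pXn2r _ 2) ?nnegrE ?normc_ge0 // normc_sqr real_normK ?num_real //.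
by rewrite lerDr sqr_ge0.
Qed.

Lemma normc_sqr_le z : normc z ^+ 2 <= norm1 z ^+ 2.
Proof.
rewrite normc_sqr /norm1 sqrrD !real_normK ?num_real //.
by have : 0 <= `|Re z| * `|Im z| by []; lra.
Qed.

Lemma norm1D z z' : norm1 (z + z') <= norm1 z + norm1 z'.
Proof.
rewrite /norm1 complex_ReD complex_ImD.
by have := ler_normD (Re z) (Re z'); have := ler_normD (Im z) (Im z'); lra.
Qed.

Lemma norm1N z : norm1 (- z) = norm1 z.
Proof. by rewrite /norm1 complex_ReN complex_ImN !normrN. Qed.

Lemma norm1B z z' : norm1 (z - z') <= norm1 z + norm1 z'.
Proof. by rewrite (le_trans (norm1D _ _)) // norm1N. Qed.

Lemma norm1_sum I (s : seq I) (F : I -> R[i]) :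
  norm1 (\sum_(i <- s) F i) <= \sum_(i <- s) norm1 (F i).
Proof.
elim/big_ind2 : _ => [|z a z' b ha hb|//]; first by rewrite /norm1 /= normr0 addr0.
exact: le_trans (norm1D _ _) (lerD _ _).
Qed.

Lemma norm1M z z' : norm1 (z * z') <= norm1 z * norm1 z'.
Proof.
rewrite /norm1 complex_ReM complex_ImM mulrDl !mulrDr -!normrM.
have := ler_normB (Re z * Re z') (Im z * Im z').
by have := ler_normD (Re z * Im z') (Im z * Re z'); lra.
Qed.

Lemma norm1Zr (a : R) z : norm1 (a%:C * z) = `|a| * norm1 z.
Proof. by rewrite /norm1 complex_ReM complex_ImM /= !mul0r subr0 addr0 !normrM mulrDr. Qed.

Definition cintegrable g :=
  circle_integrable (Re \o g) /\ circle_integrable (Im \o g).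

Definition ccontinuous g := continuous (Re \o g) /\ continuous (Im \o g).

Lemma cmeasurableD g h : cmeasurable g -> cmeasurable h ->
  cmeasurable (fun l => g l + h l).
Proof.
move=> [? ?] [? ?]; split.
- by under eq_fun do rewrite complex_ReD; exact: measurable_funD.
- by under eq_fun do rewrite complex_ImD; exact: measurable_funD.
Qed.

Lemma cmeasurableN g : cmeasurable g -> cmeasurable (fun l => - g l).
Proof.
move=> [? ?]; split.
- by under eq_fun do rewrite complex_ReN; exact: measurable_funN.
- by under eq_fun do rewrite complex_ImN; exact: measurable_funN.
Qed.

Lemma cmeasurableB g h : cmeasurable g -> cmeasurable h ->
  cmeasurable (fun l => g l - h l).
Proof. by move=> ? ?; apply: cmeasurableD => //; exact: cmeasurableN. Qed.

Lemma cmeasurableM g h : cmeasurable g -> cmeasurable h ->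
  cmeasurable (fun l => g l * h l).
Proof.
move=> [? ?] [? ?]; split.
- by under eq_fun do rewrite complex_ReM; apply: measurable_funB; exact: measurable_funM.
- by under eq_fun do rewrite complex_ImM; apply: measurable_funD; exact: measurable_funM.
Qed.

Lemma cmeasurable_real w : measurable_fun circle w ->
  cmeasurable (fun l => (w l)%:C).
Proof. by move=> ?; split => //; exact: measurable_cst. Qed.

Lemma ccontinuous_measurable g : ccontinuous g -> cmeasurable g.
Proof.
by move=> [? ?]; split; apply: measurable_funTS; exact: continuous_measurable_fun.
Qed.

Lemma ccontinuousD g h : ccontinuous g -> ccontinuous h ->
  ccontinuous (fun l => g l + h l).
Proof.
move=> [rg ig] [rh ih]; split=> x.
- rewrite (_ : _ \o _ = (Re \o g) \+ (Re \o h)); last first.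
    by apply/funext => l /=; rewrite complex_ReD.
  by apply: continuousD; [exact: rg|exact: rh].
- rewrite (_ : _ \o _ = (Im \o g) \+ (Im \o h)); last first.
    by apply/funext => l /=; rewrite complex_ImD.
  by apply: continuousD; [exact: ig|exact: ih].
Qed.

Lemma ccontinuousM g h : ccontinuous g -> ccontinuous h ->
  ccontinuous (fun l => g l * h l).
Proof.
move=> [rg ig] [rh ih]; split=> x.
- rewrite (_ : _ \o _ =
      (fun l => (Re \o g) l * (Re \o h) l - (Im \o g) l * (Im \o h) l)).
    by apply: cvgB; apply: cvgM;
      [exact: rg|exact: rh|exact: ig|exact: ih].
  by apply/funext => l /=; rewrite complex_ReM.
- rewrite (_ : _ \o _ =
      (fun l => (Re \o g) l * (Im \o h) l + (Im \o g) l * (Re \o h) l)).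
    by apply: cvgD; apply: cvgM;
      [exact: rg|exact: ih|exact: ig|exact: rh].
  by apply/funext => l /=; rewrite complex_ImM.
Qed.

Lemma ccontinuous_cst z : ccontinuous (fun=> z).
Proof. by split=> x; exact: cvg_cst. Qed.

Lemma ccontinuous_sum I (s : seq I) (F : I -> R -> R[i]) :
  (forall i, ccontinuous (F i)) ->
  ccontinuous (fun l => \sum_(i <- s) F i l).
Proof.
move=> hF; elim: s => [|i s ih].
  by under eq_fun do rewrite big_nil; exact: ccontinuous_cst.
by under eq_fun do rewrite big_cons; exact: ccontinuousD.
Qed.

Lemma ccontinuous_cexp k : ccontinuous (cexp k : R -> R[i]).
Proof.
have H (c : R) (f : R -> R) : continuous f -> continuous (fun x => f (c * x)).
  move=> cf x; apply: continuous_comp; last exact: cf.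
  exact: mulrl_continuous.
by split; [exact: (H _ _ (@continuous_cos R))|exact: (H _ _ (@continuous_sin R))].
Qed.

Lemma cexp0 l : cexp 0 l = 1 :> R[i].
Proof. by rewrite /cexp mul0r cos0 sin0. Qed.

Lemma cexpD j k l : cexp (j + k) l = cexp j l * cexp k l :> R[i].
Proof.
apply: complex_eqP; rewrite ?complex_ReM ?complex_ImM /= rmorphD /= mulrDl ?cosD ?sinD //.
by rewrite addrC.
Qed.

Lemma cexpN k l : cexp (- k) l = (cexp k l)^* :> R[i].
Proof.
by apply: complex_eqP; rewrite ?complex_ReJ ?complex_ImJ /= rmorphN /= mulNr ?cosN ?sinN.
Qed.

Lemma cexpDr k x y : cexp k (x + y) = cexp k x * cexp k y :> R[i].
Proof.
apply: complex_eqP; rewrite ?complex_ReM ?complex_ImM /= mulrDr ?cosD ?sinD //.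
by rewrite addrC.
Qed.

Lemma cexpNr k x : cexp k (- x) = cexp (- k) x :> R[i].
Proof. by rewrite /cexp rmorphN mulrN mulNr. Qed.

Lemma normc_cexp k l : normc (cexp k l : R[i]) = 1.
Proof. by rewrite /= cos2Dsin2 sqrtr1. Qed.

Lemma norm1_cexp k l : norm1 (cexp k l : R[i]) <= 2.
Proof.
rewrite /norm1; have := ler_Re_normc (cexp k l); have := ler_Im_normc (cexp k l).
by rewrite normc_cexp; lra.
Qed.

Lemma cintegrableD g h : cintegrable g -> cintegrable h ->
  cintegrable (fun l => g l + h l).
Proof.
move=> [? ?] [? ?]; split; rewrite /comp.
- by under eq_fun do rewrite complex_ReD; exact: circle_integrableD.
- by under eq_fun do rewrite complex_ImD; exact: circle_integrableD.
Qed.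

Lemma cintegrableZ z g : cintegrable g -> cintegrable (fun l => z * g l).
Proof.
move=> [? ?]; split; rewrite /comp.
- under eq_fun do rewrite complex_ReM.
  by apply: circle_integrableB; exact: circle_integrableZ.
- under eq_fun do rewrite complex_ImM.
  by apply: circle_integrableD; exact: circle_integrableZ.
Qed.

Lemma cintegrable_sum I (s : seq I) (F : I -> R -> R[i]) :
  (forall i, cintegrable (F i)) -> cintegrable (fun l => \sum_(i <- s) F i l).
Proof.
move=> hF; elim: s => [|i s ih].
  by under eq_fun do rewrite big_nil; split; exact: circle_integrable_cst.
by under eq_fun do rewrite big_cons; exact: cintegrableD.
Qed.

Lemma cintegrable_weight w g M : circle_integrable w -> cmeasurable g ->
  (forall l, circle l -> norm1 (g l) <= M) ->
  cintegrable (fun l => (w l)%:C * g l).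
Proof.
move=> iw [mr mi] gM; have mw := circle_integrable_measurable iw.
have iwM : circle_integrable (fun l => M * `|w l|).
  by apply: circle_integrableZ; exact: circle_integrable_norm.
split; apply: (circle_integrable_le _ iwM); rewrite /comp.
- by under eq_fun do rewrite complex_ReM /= mul0r subr0; exact: measurable_funM.
- move=> l cl; rewrite complex_ReM /= mul0r subr0 normrM mulrC ler_wpM2r //.
  by apply: le_trans (gM _ cl); rewrite lerDl.
- by under eq_fun do rewrite complex_ImM /= mul0r addr0; exact: measurable_funM.
- move=> l cl; rewrite complex_ImM /= mul0r addr0 normrM mulrC ler_wpM2r //.
  by apply: le_trans (gM _ cl); rewrite lerDr.
Qed.

Lemma cintegrable_bounded g M : cmeasurable g ->
  (forall l, circle l -> norm1 (g l) <= M) -> cintegrable g.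
Proof.
move=> mg gM; have := cintegrable_weight (circle_integrable_cst 1) mg gM.
by under eq_fun do rewrite mul1r.
Qed.

Lemma cintegrable_norm1 g : cintegrable g ->
  circle_integrable (fun l => norm1 (g l)).
Proof.
by move=> [? ?]; apply: circle_integrableD; exact: circle_integrable_norm.
Qed.

Lemma cmeanE g : cmean g = rmean (Re \o g) +i* rmean (Im \o g).
Proof. by []. Qed.

Lemma eq_cmean g h : g =1 h -> cmean g = cmean h.
Proof. by move=> /funext ->. Qed.

Lemma cmeanD g h : cintegrable g -> cintegrable h ->
  cmean (fun l => g l + h l) = cmean g + cmean h.
Proof.
move=> [? ?] [? ?]; apply: complex_eqP; rewrite ?complex_ReD ?complex_ImD !cmeanE /=.
- by rewrite -rmeanD //; apply: eq_rmean => l /=; rewrite complex_ReD.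
- by rewrite -rmeanD //; apply: eq_rmean => l /=; rewrite complex_ImD.
Qed.

Lemma cmeanZ z g : cintegrable g -> cmean (fun l => z * g l) = z * cmean g.
Proof.
move=> [? ?]; apply: complex_eqP; rewrite ?complex_ReM ?complex_ImM !cmeanE /=.
- rewrite -!rmeanZ // -rmeanB; try exact: circle_integrableZ.
  by apply: eq_rmean => l /=; rewrite complex_ReM.
- rewrite -!rmeanZ // -rmeanD; try exact: circle_integrableZ.
  by apply: eq_rmean => l /=; rewrite complex_ImM.
Qed.

Lemma cmeanB g h : cintegrable g -> cintegrable h ->
  cmean (fun l => g l - h l) = cmean g - cmean h.
Proof.
move=> ig ih; rewrite -mulN1r -cmeanZ // -cmeanD //; last exact: cintegrableZ.
by apply: eq_cmean => l; rewrite mulN1r.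
Qed.

Lemma cmean_sum I (s : seq I) (F : I -> R -> R[i]) :
  (forall i, cintegrable (F i)) ->
  cmean (fun l => \sum_(i <- s) F i l) = \sum_(i <- s) cmean (F i).
Proof.
move=> hF; elim: s => [|i s ih].
  under eq_fun do rewrite big_nil.
  by rewrite big_nil cmeanE /comp !rmean_cst.
under eq_fun do rewrite big_cons.
by rewrite big_cons cmeanD ?ih //; exact: cintegrable_sum.
Qed.

Lemma norm1_cmean g : cintegrable g ->
  norm1 (cmean g) <= rmean (fun l => norm1 (g l)).
Proof.
move=> [ir ii]; rewrite rmeanD; try exact: circle_integrable_norm.
by apply: lerD; exact: ler_norm_rmean.
Qed.

(** The fundamental theorem of calculus; applied to explicit primitives of cos (k x) and sin (k x),
    it gives the orthogonality of the exponentials. *)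
Lemma rmean_derive (f F : R -> R) : continuous f ->
  (forall x : R, is_derive x 1 F (f x)) -> F pi = F (- pi) -> rmean f = 0.
Proof.
move=> cf dF eF.
have ltpi : - pi < pi :> R by have := pi_gt0 R; lra.
have cF : continuous F.
  by move=> x; apply: differentiable_continuous; apply/derivable1_diffP.
rewrite /rmean /Rintegral (@continuous_FTC2 _ f F) //.
- by rewrite eF subee //= mulr0.
- exact: continuous_subspaceT.
- split=> [x _||]; first by [].
  + by apply: cvg_at_right_filter; exact: cF.
  + by apply: cvg_at_left_filter; exact: cF.
- by move=> x _; rewrite derive1E derive_val.
Qed.

Lemma sin_intpi (k : int) : sin (k%:~R * pi : R) = 0.
Proof.
have H n : sin (n%:R * pi : R) = 0.
  rewrite mulr_natl -[_ *+ _]add0r (alternatingn (@sinDpi R)) sin0 mulr0.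
  by [].
case: k => n; first exact: H.
by rewrite NegzE rmorphN mulNr sinN (H n.+1) oppr0.
Qed.

Lemma cmean_cexp k : cmean (cexp k) = (k == 0)%:R :> R[i].
Proof.
have [->|k0] := eqVneq k 0.
  rewrite -[RHS]/(1 +i* 0) cmeanE; congr Complex.
  - by rewrite -[RHS]rmean_cst; apply: eq_rmean => l; rewrite /= mul0r cos0.
  - by rewrite -[RHS]rmean_cst; apply: eq_rmean => l; rewrite /= mul0r sin0.
have kR0 : k%:~R != 0 :> R by rewrite intr_eq0.
have [cre cim] := ccontinuous_cexp k.
have dk (x : R) : is_derive x 1 ( *%R k%:~R) k%:~R.
  have := @is_deriveZ R R R id k%:~R x 1 1 (is_derive_id _ _).
  by rewrite /GRing.scale /= mulr1.
rewrite cmeanE; congr Complex.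
- apply: (@rmean_derive _ (fun x => k%:~R^-1 * sin (k%:~R * x))) => // [x|].
    have := is_derive1_comp (is_deriveZ k%:~R^-1 (is_derive_sin (k%:~R * x)))
      (dk x).
    by rewrite /GRing.scale /= mulrAC mulVf // mul1r.
  by rewrite mulrN sinN sin_intpi oppr0.
- apply: (@rmean_derive _ (fun x => - k%:~R^-1 * cos (k%:~R * x))) => // [x|].
    have := is_derive1_comp (is_deriveZ (- k%:~R^-1) (is_derive_cos (k%:~R * x)))
      (dk x).
    by rewrite /GRing.scale /= mulrNN mulrAC mulVf // mul1r.
  by rewrite mulrN cosN.
Qed.

End ComplexMeans.

(** * Fejer means *)

Section Fejer.
Context {R : realType}.
Local Notation mu := (@lebesgue_measure R).
Local Notation Re := (@complex.Re R).
Local Notation Im := (@complex.Im R).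
Implicit Types (g h : R -> R[i]) (z : R[i]) (w : R -> R).

Lemma continuous_circle_integrable w : continuous w -> circle_integrable w.
Proof.
move=> cw; apply: continuous_compact_integrable; first exact: segment_compact.
exact: continuous_subspaceT.
Qed.

Lemma ccontinuous_integrable g : ccontinuous g -> cintegrable g.
Proof. by move=> [? ?]; split; exact: continuous_circle_integrable. Qed.

(** The Fejer kernel as a squared modulus: nonnegativity is immediate, and expanding the square
    gives a trigonometric polynomial. *)
Definition fejer n (s : R) : R :=
  n.+1%:R^-1 * normc (\sum_(j < n.+1) cexp j%:Z s) ^+ 2.

(** Frequencies are indexed by pairs, not collected: the frequency m comes from n + 1 - |m| pairs,
    which is the usual triangular weight. *)
Definition fejer_freq n (p : 'I_n.+1 * 'I_n.+1) : int := p.1%:Z - p.2%:Z.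

Lemma fejer_ge0 n s : 0 <= fejer n s.
Proof. by rewrite mulr_ge0 ?invr_ge0 ?ler0n ?sqr_ge0. Qed.

Lemma fejerE n s :
  (fejer n s)%:C = \sum_p (n.+1%:R^-1)%:C * cexp (@fejer_freq n p) s.
Proof.
rewrite /fejer rmorphM /= normc_sqrJ rmorph_sum /= -big_distrr /=.
congr (_ * _); rewrite big_distrlr /= pair_bigA; apply: eq_bigr => p _.
by rewrite /fejer_freq cexpD cexpN.
Qed.

Lemma fejer_shiftE n x t : (fejer n (x - t))%:C =
  \sum_p (n.+1%:R^-1)%:C * cexp (@fejer_freq n p) x * cexp (- fejer_freq p) t.
Proof.
by rewrite fejerE; apply: eq_bigr => p _; rewrite cexpDr cexpNr mulrA.
Qed.

Lemma ccontinuous_fejer n x : ccontinuous (fun t => (fejer n (x - t))%:C).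
Proof.
under eq_fun do rewrite fejer_shiftE.
apply: ccontinuous_sum => p; apply: ccontinuousM; last exact: ccontinuous_cexp.
exact: ccontinuous_cst.
Qed.

Lemma circle_integrable_fejer n x : circle_integrable (fun t => fejer n (x - t)).
Proof. exact: (ccontinuous_integrable (ccontinuous_fejer n x)).1. Qed.

(** By orthogonality this counts the pairs of frequency -q. The values q = 0 and q = 1 give the two
    moments that Korovkin's argument uses. *)
Lemma cmean_cexp_fejer n x (q : int) :
  cmean (fun t => cexp q (x - t) * (fejer n (x - t))%:C) =
  (n.+1%:R^-1)%:C * \sum_p ((q + @fejer_freq n p == 0)%:R).
Proof.
have E t : cexp q (x - t) * (fejer n (x - t))%:C = \sum_p
    ((n.+1%:R^-1)%:C * cexp (q + @fejer_freq n p) x) *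
    cexp (- (q + fejer_freq p)) t.
  rewrite fejerE big_distrr /=; apply: eq_bigr => p _.
  by rewrite mulrCA -cexpD cexpDr cexpNr mulrA.
rewrite (eq_cmean E) cmean_sum => [|p]; last first.
  apply: cintegrableZ; apply: ccontinuous_integrable; exact: ccontinuous_cexp.
rewrite big_distrr /=; apply: eq_bigr => p _; rewrite cmeanZ; last first.
  by apply: ccontinuous_integrable; exact: ccontinuous_cexp.
rewrite cmean_cexp oppr_eq0 -mulrA; congr (_ * _).
by case: eqP => [->|_]; rewrite ?cexp0 ?mulr1 ?mulr0.
Qed.

Lemma rmean_fejer n x : rmean (fun t => fejer n (x - t)) = 1.
Proof.
have -> : rmean (fun t => fejer n (x - t)) =
    Re (cmean (fun t => cexp 0 (x - t) * (fejer n (x - t))%:C)).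
  by rewrite cmeanE; apply: eq_rmean => t; rewrite /comp cexp0 mul1r.
rewrite cmean_cexp_fejer -(pair_bigA _ (fun j k : 'I_n.+1 =>
  (0 + (j%:Z - k%:Z) == 0)%:R)) /=.
rewrite (eq_bigr (fun=> 1)) => [|j _].
  rewrite sumr_const card_ord -(rmorph_nat (real_complex R)) complex_ReM /=.
  by rewrite mul0r subr0 mulVf ?pnatr_eq0.
rewrite (bigD1 j) //= add0r subrr eqxx big1 ?addr0 // => k kj.
rewrite add0r subr_eq0 eqz_nat eq_sym; case: eqP => // e.
by case/eqP: kj; exact/val_inj.
Qed.

Lemma rmean_cos_fejer n x :
  rmean (fun t => (1 - cos (x - t)) * fejer n (x - t)) = n.+1%:R^-1.
Proof.
have Icos : circle_integrable (fun t => cos (x - t) * fejer n (x - t)).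
  apply: (@eq_circle_integrable _ (Re \o
     (fun t => cexp 1 (x - t) * (fejer n (x - t))%:C))) => [t|].
    by rewrite /= mul1r mulr0 subr0.
  apply: (ccontinuous_integrable _).1; apply: ccontinuousM.
    under eq_fun do rewrite cexpDr cexpNr.
    by apply: ccontinuousM; [exact: ccontinuous_cst|exact: ccontinuous_cexp].
  exact: ccontinuous_fejer.
under eq_rmean do rewrite mulrBl mul1r.
rewrite rmeanB //; last exact: circle_integrable_fejer.
rewrite rmean_fejer.
have -> : rmean (fun t => cos (x - t) * fejer n (x - t)) =
    Re (cmean (fun t => cexp 1 (x - t) * (fejer n (x - t))%:C)).
  by rewrite cmeanE; apply: eq_rmean => t; rewrite /= mul1r mulr0 subr0.
rewrite cmean_cexp_fejer -(pair_bigA _ (fun j k : 'I_n.+1 =>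
  (1 + (j%:Z - k%:Z) == 0)%:R)) /=.
(* The pairs wanted have second index j + 1, which leaves the range when j = n; the other n values
   of j contribute one pair each, so the cosine has mean n / (n + 1). *)
rewrite big_ord_recr /= [X in _ * (_ + X)]big1 => [|k _]; last first.
  by rewrite addrA subr_eq0 -intS eqz_nat gtn_eqF.
rewrite addr0 (eq_bigr (fun=> 1)) => [|j _].
  rewrite sumr_const card_ord -(rmorph_nat (real_complex R)) complex_ReM /=.
  rewrite mul0r subr0 -natr1.
  by field; rewrite natr1 pnatr_eq0.
rewrite (bigD1 (lift ord0 j)) //= /bump leq0n addrA -intS subrr eqxx.
rewrite big1 ?addr0 // => k kj.
rewrite addrA -intS subr_eq0 eqz_nat eq_sym; case: eqP => // e.
by case/eqP: kj; apply/val_inj.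
Qed.

Definition fejer_mean n g x : R[i] := cmean (fun t => (fejer n (x - t))%:C * g t).

End Fejer.

(** * Pointwise convergence of Fejer means and their frequencies *)

Section Approximation.
Context {R : realType}.
Local Notation mu := (@lebesgue_measure R).
Local Notation Re := (@complex.Re R).
Local Notation Im := (@complex.Im R).
Implicit Types (g h : R -> R[i]) (z : R[i]) (w : R -> R).

Lemma rmean_weight_norm1 w g M : circle_integrable w -> cmeasurable g ->
  (forall l, circle l -> 0 <= w l) ->
  (forall l, circle l -> norm1 (g l) <= M) ->
  circle_integrable (fun l => w l * norm1 (g l)) /\
  norm1 (cmean (fun l => (w l)%:C * g l)) <= rmean (fun l => w l * norm1 (g l)).
Proof.
move=> iw mg w0 gM; have iwg := cintegrable_weight iw mg gM.
have iwn : circle_integrable (fun l => w l * norm1 (g l)).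
  have mw := circle_integrable_measurable iw; case: (mg) => mr mi.
  have iMw := circle_integrableZ M iw.
  apply: (circle_integrable_le _ iMw).
    apply: measurable_funM => //; apply: measurable_funD;
    exact: measurableT_comp.
  move=> l cl; rewrite ger0_norm; last by rewrite mulr_ge0 ?norm1_ge0 ?w0.
  by rewrite mulrC ler_wpM2r ?w0 ?gM.
split=> //; apply: le_trans (norm1_cmean iwg) _.
apply: le_rmean => //; first exact: cintegrable_norm1.
by move=> l cl; rewrite norm1Zr ger0_norm ?w0.
Qed.

Lemma norm1_fejer_mean n g M x : cmeasurable g ->
  (forall l, circle l -> norm1 (g l) <= M) -> norm1 (fejer_mean n g x) <= M.
Proof.
move=> mg gM.
have [i1 le1] := rmean_weight_norm1 (circle_integrable_fejer n x) mg
  (fun l _ => fejer_ge0 n (x - l)) gM.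
apply: (le_trans le1); rewrite -[leRHS]mulr1 -[X in _ * X](rmean_fejer n x) -rmeanZ;
  last exact: circle_integrable_fejer.
apply: le_rmean => // [|l cl].
  by apply: circle_integrableZ; exact: circle_integrable_fejer.
by rewrite mulrC ler_wpM2r ?fejer_ge0 ?gM.
Qed.

(** Korovkin's argument: the kernel is nonnegative, has mean one, and has mean 1 / (n + 1) against 1
    - cos, so a pointwise bound by these two test functions survives averaging. No tail estimate of
    the kernel is involved. *)
Lemma fejer_mean_korovkin n g M x (e C : R) : cmeasurable g ->
  (forall l, circle l -> norm1 (g l) <= M) ->
  (forall l, circle l -> norm1 (g l - g x) <= e + C * (1 - cos (x - l))) ->
  norm1 (fejer_mean n g x - g x) <= e + C * n.+1%:R^-1.
Proof.
move=> mg gM gx.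
have mc : cmeasurable (fun=> g x).
  by apply: ccontinuous_measurable; exact: ccontinuous_cst.
have iF := circle_integrable_fejer n x.
have -> : fejer_mean n g x - g x =
    cmean (fun t => (fejer n (x - t))%:C * (g t - g x)).
  under eq_cmean do rewrite mulrBr.
  rewrite cmeanB; [|exact: cintegrable_weight iF mg gM|]; last first.
    exact: (cintegrable_weight (M := norm1 (g x)) iF).
  congr (_ - _); under eq_cmean do rewrite mulrC.
  rewrite cmeanZ; last first.
    by split; [exact: iF|exact: circle_integrable_cst].
  rewrite cmeanE (_ : _ \o _ = fun t => fejer n (x - t)) // rmean_fejer.
  by rewrite (_ : _ \o _ = fun=> 0) // rmean_cst mulr1.
have gM2 l : circle l -> norm1 (g l - g x) <= M + norm1 (g x).
  by move=> cl; rewrite (le_trans (norm1B _ _)) // lerD2r gM.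
have [i1 le1] := rmean_weight_norm1 iF (cmeasurableB mg mc)
  (fun l _ => fejer_ge0 n (x - l)) gM2.
apply: (le_trans le1).
have Icos : circle_integrable (fun t => (1 - cos (x - t)) * fejer n (x - t)).
  have mcos : measurable_fun circle (fun t => 1 - cos (x - t) : R).
    apply: measurable_funB => //; apply: measurable_funTS.
    apply: continuous_measurable_fun => t.
    apply: (@continuous_comp _ _ _ (fun t => x - t) (@cos R));
      last exact: continuous_cos.
    by apply: cvgB; [exact: cvg_cst|exact: cvg_id].
  apply: (circle_integrable_le _ (circle_integrableZ 2 iF)).
    by apply: measurable_funM => //; exact: circle_integrable_measurable.
  move=> t _; rewrite normrM (ger0_norm (fejer_ge0 _ _)) ler_wpM2r ?fejer_ge0 //.
  by rewrite ger0_norm ?subr_ge0 ?cos_le1 //; have := cos_geN1 (x - t); lra.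
have -> : e + C * n.+1%:R^-1 = e * rmean (fun t => fejer n (x - t)) +
    C * rmean (fun t => (1 - cos (x - t)) * fejer n (x - t)).
  by rewrite rmean_fejer rmean_cos_fejer mulr1.
rewrite -!rmeanZ // -rmeanD; try exact: circle_integrableZ.
apply: le_rmean => //.
  by apply: circle_integrableD; exact: circle_integrableZ.
move=> l cl.
have -> : e * fejer n (x - l) + C * ((1 - cos (x - l)) * fejer n (x - l)) =
  (e + C * (1 - cos (x - l))) * fejer n (x - l) by ring.
by rewrite mulrC ler_wpM2r ?fejer_ge0 ?gx.
Qed.

Lemma cos_nonincreasing (a b : R) : 0 <= a -> a <= b -> b <= pi ->
  cos b <= cos a.
Proof.
move=> a0; rewrite le_eqVlt => /predU1P[-> //|ab] bpi.
by rewrite ltW // (@ltr_cos R) // in_itv /=; apply/andP; split; lra.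
Qed.

(** Since [x] stays [d] away from both end points, |x - l| is at most 2 pi - d, so x - l keeps
    distance [d] from every multiple of 2 pi. *)
Lemma cos_dist_le (d x l : R) : 0 < d -> `|x| <= pi - d -> circle l ->
  d <= `|x - l| -> cos (x - l) <= cos d.
Proof.
move=> d0 xd; rewrite /circle /= in_itv /= => /andP[l1 l2] dxl.
have x1 := ler_norm x; have x2 := ler_norm (- x); rewrite normrN in x2.
have -> : cos (x - l) = cos `|x - l|.
  by case: (ger0P (x - l)) => // _; rewrite cosN.
have ub : `|x - l| <= 2 * pi - d by rewrite ler_norml; lra.
have [hle|hgt] := leP `|x - l| pi.
  by apply: cos_nonincreasing; lra.
(* Beyond pi, reflect: 2 pi - |x - l| lies between [d] and pi and has the same cosine. *)
by rewrite -cosN -(cosD2pi (- `|x - l|)); apply: cos_nonincreasing; lra.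
Qed.

(** Near [x] continuity gives [e]; at distance [d] or more, 1 - cos (x - l) is at least 1 - cos d,
    and the crude bound 2 M is absorbed into [C]. As [g] is not assumed periodic, [x] must be
    interior: otherwise points near the opposite end would count as close to [x]. *)
Lemma korovkin_bound g M x (e : R) : ccontinuous g -> `|x| < pi -> 0 < e ->
  (forall l, circle l -> norm1 (g l) <= M) ->
  exists C : R, forall l, circle l ->
    norm1 (g l - g x) <= e + C * (1 - cos (x - l)).
Proof.
move=> [cr ci] xpi e0 gM.
have e20 : 0 < e / 2 by rewrite divr_gt0.
have /cvgrPdist_lt/(_ _ e20)/nbhs_ballP[d1 /= d10 h1] := cr x.
have /cvgrPdist_lt/(_ _ e20)/nbhs_ballP[d2 /= d20 h2] := ci x.
pose d := Num.min (Num.min d1 d2) (pi - `|x|).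
have d0 : 0 < d by rewrite !lt_min d10 d20 subr_gt0 xpi.
have [dd1 dd2 ddp] : [/\ d <= d1, d <= d2 & d <= pi - `|x|].
  by rewrite /d; split; rewrite ?ge_min ?lexx ?orbT.
have cd1 : 0 < 1 - cos d.
  rewrite subr_gt0 -cos0 (@ltr_cos R) // in_itv /=.
    by rewrite lexx pi_ge0.
  by rewrite ltW //= (le_trans ddp) // gerBl.
have cx : circle x.
  by rewrite /circle /= in_itv /= -ler_norml ltW.
have M0 : 0 <= M by rewrite (le_trans (norm1_ge0 _) (gM x cx)).
exists (2 * M / (1 - cos d)) => l cl.
have cosl : 0 <= 1 - cos (x - l) by rewrite subr_ge0 cos_le1.
have C0 : 0 <= 2 * M / (1 - cos d) by rewrite divr_ge0 ?mulr_ge0 // ltW.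
have [xl|xl] := ltP `|x - l| d.
  have r := h1 l (lt_le_trans xl dd1); have i := h2 l (lt_le_trans xl dd2).
  rewrite /= distrC in r; rewrite /= distrC in i.
  have : norm1 (g l - g x) <= e.
    by rewrite /norm1 complex_ReD complex_ImD complex_ReN complex_ImN; lra.
  by have := mulr_ge0 C0 cosl; lra.
have hc : cos (x - l) <= cos d.
  by apply: cos_dist_le => //; lra.
apply: (@le_trans _ _ (2 * M)).
  rewrite (le_trans (norm1B _ _)) //; have := gM _ cl; have := gM _ cx; lra.
rewrite -[leLHS](divfK (lt0r_neq0 cd1)).
have : 2 * M / (1 - cos d) * (1 - cos d) <= 2 * M / (1 - cos d) * (1 - cos (x - l)).
  by rewrite ler_wpM2l //; lra.
by lra.
Qed.

(** Each frequency of the Fejer mean carries a multiple of the Fourier coefficient of [g] there, so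
    no frequency with vanishing coefficient is created. *)
Lemma fejer_mean_sum n g : cintegrable g -> forall x,
  (forall m, cintegrable (fun t => g t * cexp m t)) ->
  fejer_mean n g x = \sum_p ((n.+1%:R^-1)%:C *
    cmean (fun t => g t * cexp (- @fejer_freq n p) t)) * cexp (fejer_freq p) x.
Proof.
move=> ig x im.
have E t : (fejer n (x - t))%:C * g t = \sum_p
    ((n.+1%:R^-1)%:C * cexp (@fejer_freq n p) x) *
    (g t * cexp (- fejer_freq p) t).
  rewrite fejer_shiftE big_distrl /=; apply: eq_bigr => p _.
  by rewrite -!mulrA; do 2 congr (_ * _); rewrite mulrC.
rewrite /fejer_mean (eq_cmean E) cmean_sum => [|p]; last exact: cintegrableZ.
by apply: eq_bigr => p _; rewrite cmeanZ // mulrAC.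
Qed.

(** [observed_span] takes the coefficient as a function of the frequency, whereas the double sum of
    the Fejer mean repeats frequencies: equal ones are grouped, and the forbidden ones, having zero
    coefficients, are dropped. *)
Lemma observed_span_sum (N : nat) (I : eqType) (r : seq I) (m : I -> int)
    (d : I -> R[i]) :
  (forall i, (0 <= m i <= N%:Z) -> d i = 0) ->
  observed_span N (fun l => \sum_(i <- r) d i * cexp (m i) l).
Proof.
move=> dm; pose s := [seq j <- undup (map m r) | ~~ (0 <= j <= N%:Z)].
exists s, (fun j => \sum_(i <- r | m i == j) d i); split; first exact: filter_all.
apply/funext => l; under [RHS]eq_bigr do rewrite big_distrl /= big_mkcond /=.
rewrite exchange_big /= !big_seq; apply: eq_bigr => i ir.
have [out|/negbNE/dm ->] := boolP (~~ (0 <= m i <= N%:Z)); last first.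
  by rewrite mul0r big1 // => j _; rewrite mul0r if_same.
rewrite (bigD1_seq (m i)) /= ?filter_uniq ?undup_uniq //; last first.
  by rewrite mem_filter out mem_undup map_f.
by rewrite eqxx big1 ?addr0 // => j; rewrite eq_sym => /negbTE ->.
Qed.

End Approximation.

(** * Convergence in mean and bounded continuous approximation *)

Section Approximation2.
Context {R : realType}.
Local Notation mu := (@lebesgue_measure R).
Local Notation Re := (@complex.Re R).
Local Notation Im := (@complex.Im R).
Implicit Types (g h : R -> R[i]) (z : R[i]) (w : R -> R).

Lemma ae_circle_interior : ae_circle (fun x : R => `|x| < pi).
Proof.
exists [set - pi; pi]; split.
- exact: measurableU.
- apply: countable_lebesgue_measure0; exact/finite_set_countable/finite_set2.
- move=> x /= /not_implyP[]; rewrite /circle /= in_itv /= -ler_norml.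
  rewrite le_eqVlt => /orP[/eqP <- _|->//].
  by case: (ger0P x) => _; [right|left; rewrite opprK].
Qed.

Lemma ccontinuous_fejer_mean n g : ccontinuous g -> ccontinuous (fejer_mean n g).
Proof.
move=> cg; have ig m : cintegrable (fun t => g t * cexp m t).
  by apply/ccontinuous_integrable/ccontinuousM => //; exact: ccontinuous_cexp.
have -> := funext (fun x => fejer_mean_sum n (ccontinuous_integrable cg) x ig).
apply: ccontinuous_sum => p; apply: ccontinuousM; last exact: ccontinuous_cexp.
exact: ccontinuous_cst.
Qed.

Lemma cmeasurable_norm1 g : cmeasurable g ->
  measurable_fun circle (fun l => norm1 (g l)).
Proof.
by move=> [? ?]; apply: measurable_funD; exact: measurableT_comp.
Qed.

Lemma half_add_small (d C u : R) : 0 <= u -> u < d / 2 / (`|C| + 1) ->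
  d / 2 + C * u < d.
Proof.
move=> u0; rewrite ltr_pdivlMr ?ltr_pwDr // mulrDr mulr1 => ud.
have : C * u <= u * `|C| by rewrite mulrC ler_wpM2l ?ler_norm.
by lra.
Qed.

(** The values of [g] at the two end points may differ, so uniform convergence can fail. Convergence
    at interior points together with the common bound 2 M gives convergence in mean by
    domination. *)
Lemma fejer_mean_cvg g M (e : R) : ccontinuous g ->
  (forall l, circle l -> norm1 (g l) <= M) -> 0 < e ->
  exists n, rmean (fun x => norm1 (fejer_mean n g x - g x)) < e.
Proof.
move=> cg gM e0; have mg := ccontinuous_measurable cg.
have mu_n n : measurable_fun circle (fun x => norm1 (fejer_mean n g x - g x)).
  apply: cmeasurable_norm1; apply: cmeasurableB => //.
  by apply: ccontinuous_measurable; exact: ccontinuous_fejer_mean.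
have u_M n x : circle x -> norm1 (fejer_mean n g x - g x) <= M + M.
  move=> cx; apply: le_trans (norm1B _ _) _.
  by rewrite lerD ?gM ?norm1_fejer_mean.
have iu n : circle_integrable (fun x => norm1 (fejer_mean n g x - g x)).
  apply: (@circle_integrable_bounded _ _ (M + M)) => // l cl.
  by rewrite ger0_norm ?norm1_ge0 ?u_M.
have [] := @dominated_convergence _ _ _ mu _ (@measurable_circle R)
  (fun n x => (norm1 (fejer_mean n g x - g x))%:E) (cst 0%E) (cst (M + M)%:E).
- by move=> n; apply/measurable_EFinP; exact: mu_n.
- exact: measurable_cst.
- apply: ae_circleS ae_circle_interior => x cx xpi.
  apply/fine_cvgP; split; first by exists 0%N.
  apply/cvgrPdist_lt => /= d d0.
  have [|C hC] := @korovkin_bound R g M x (d / 2) cg xpi _ gM.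
    by rewrite divr_gt0.
  have dC : 0 < d / 2 / (`|C| + 1).
    by rewrite !divr_gt0 // ltr_pwDr.
  near=> n; rewrite /= sub0r normrN ger0_norm ?norm1_ge0 //.
  apply: le_lt_trans (fejer_mean_korovkin n mg gM hC) _.
  have nC : n.+1%:R^-1 < d / 2 / (`|C| + 1).
    by near: n; exact: (near_infty_natSinv_lt (PosNum dC)).
  by apply: half_add_small; rewrite ?invr_ge0.
- exact: circle_integrable_cst.
- apply: aeW => x n cx; rewrite /= lee_fin ger0_norm ?norm1_ge0 //.
  exact: u_M.
move=> _ _; rewrite integral0 => /fine_cvg /cvgrPdist_lt.
have e1 : 0 < 2 * pi * e by rewrite !mulr_gt0 ?pi_gt0.
move=> /(_ _ e1) [n _ /(_ n (leqnn n))]; rewrite /= sub0r normrN => h.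
exists n; rewrite /rmean mulrC ltr_pdivrMr ?mulr_gt0 ?pi_gt0 // mulrC.
exact: le_lt_trans (ler_norm _) h.
Unshelve. all: by end_near. Qed.

(** For nonnegative [M], truncation to [-M, M]; written with absolute values, it inherits continuity
    and the Lipschitz bound from them. *)
Definition clip (M x : R) : R := (`|x + M| - `|x - M|) / 2.

Lemma norm_clip M x : 0 <= M -> `|clip M x| <= M.
Proof.
move=> M0; rewrite /clip ler_norml.
by case: (ger0P (x + M)); case: (ger0P (x - M)); lra.
Qed.

Lemma clip_id M x : `|x| <= M -> clip M x = x.
Proof.
rewrite ler_norml /clip.
by case: (ger0P (x + M)); case: (ger0P (x - M)); lra.
Qed.

Lemma clip_lipschitz M x y : `|clip M x - clip M y| <= `|x - y|.
Proof.
have h1 := ler_dist_dist (x + M) (y + M).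
have h2 := ler_dist_dist (x - M) (y - M).
have e1 : x + M - (y + M) = x - y by ring.
have e2 : x - M - (y - M) = x - y by ring.
rewrite e1 ler_norml in h1; rewrite e2 ler_norml in h2.
by rewrite ler_norml /clip; lra.
Qed.

Lemma continuous_clip M : continuous (clip M).
Proof.
move=> x; apply: cvgMl; apply: cvgB.
  apply: (@continuous_comp _ _ _ (fun t => t + M) (@Num.norm R R));
    last exact: norm_continuous.
  by apply: cvgD; [exact: cvg_id|exact: cvg_cst].
apply: (@continuous_comp _ _ _ (fun t => t - M) (@Num.norm R R));
  last exact: norm_continuous.
by apply: cvgB; [exact: cvg_id|exact: cvg_cst].
Qed.

(** Density of continuous functions in L_1 gives no uniform bound. Truncation restores it without
    increasing the error, being 1-Lipschitz and fixing the values of [w]. *)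
Lemma continuous_approx w M (e : R) : 0 <= M -> measurable_fun circle w ->
  (forall l, circle l -> `|w l| <= M) -> 0 < e ->
  exists v : R -> R, [/\ continuous v, (forall l, `|v l| <= M) &
    rmean (fun l => `|w l - v l|) < e].
Proof.
move=> M0 mw wM e0; have iw := circle_integrable_bounded mw wM.
have [v [cv iv]] := approximation_continuous_integrable
  (@measurable_circle R) (@mu_circle_lty R) iw.
have e1 : 0 < 2 * pi * e by rewrite !mulr_gt0 ?pi_gt0.
move=> /fine_cvg /cvgrPdist_lt /(_ _ e1) [n _ /(_ n (leqnn n))].
rewrite /= sub0r normrN => h.
have cc : continuous (clip M \o v n).
  by move=> x; apply: continuous_comp; [exact: cv|exact: continuous_clip].
exists (clip M \o v n); split => // [l|]; first exact: norm_clip.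
apply: (@le_lt_trans _ _ (rmean (fun l => `|w l - v n l|))).
  apply: le_rmean.
  - apply: circle_integrable_norm; apply: circle_integrableB => //.
    exact: continuous_circle_integrable.
  - by apply: circle_integrable_norm; apply: circle_integrableB => //; exact: iv.
  - by move=> l cl; rewrite -{1}(clip_id (wM l cl)) /= clip_lipschitz.
rewrite /rmean mulrC ltr_pdivrMr ?mulr_gt0 ?pi_gt0 // mulrC.
exact: le_lt_trans (ler_norm _) h.
Qed.

End Approximation2.

(** * Bounded functions with vanishing coefficients are admissible *)

Section ObservedApproximation.
Context {R : realType}.
Local Notation mu := (@lebesgue_measure R).
Local Notation Re := (@complex.Re R).
Local Notation Im := (@complex.Im R).
Implicit Types (g h : R -> R[i]) (z : R[i]) (w f : R -> R).

Lemma cmeasurable_cexp k : cmeasurable (cexp k : R -> R[i]).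
Proof. by apply: ccontinuous_measurable; exact: ccontinuous_cexp. Qed.

Lemma cintegrable_coef g M k : cmeasurable g ->
  (forall l, circle l -> norm1 (g l) <= M) ->
  cintegrable (fun l => g l * cexp k l).
Proof.
move=> mg gM; apply: (@cintegrable_bounded _ _ (M * 2)).
  by apply: cmeasurableM => //; exact: cmeasurable_cexp.
move=> l cl; apply: le_trans (norm1M _ _) _.
by apply: ler_pM; rewrite ?norm1_ge0 ?gM ?norm1_cexp.
Qed.

Lemma circle_integrable_norm1 g M : cmeasurable g ->
  (forall l, circle l -> norm1 (g l) <= M) ->
  circle_integrable (fun l => norm1 (g l)).
Proof. by move=> mg gM; exact: cintegrable_norm1 (cintegrable_bounded mg gM). Qed.

Lemma norm1_coef g M k : cmeasurable g ->
  (forall l, circle l -> norm1 (g l) <= M) ->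
  norm1 (cmean (fun l => g l * cexp k l)) <= 2 * rmean (fun l => norm1 (g l)).
Proof.
move=> mg gM; have ig := cintegrable_coef k mg gM.
have i1 := circle_integrable_norm1 mg gM.
apply: le_trans (norm1_cmean ig) _; rewrite -rmeanZ //.
apply: le_rmean; [exact: cintegrable_norm1|exact: circle_integrableZ|].
move=> l cl; apply: le_trans (norm1M _ _) _.
by rewrite mulrC ler_wpM2r ?norm1_ge0 ?norm1_cexp.
Qed.

Lemma ccontinuous_approx h M (e : R) : cmeasurable h ->
  (forall l, circle l -> norm1 (h l) <= M) -> 0 < e ->
  exists g, [/\ ccontinuous g, (forall l, norm1 (g l) <= 2 * M) &
    rmean (fun l => norm1 (h l - g l)) < e].
Proof.
move=> [mr mi] hM e0; have e2 : 0 < e / 2 by rewrite divr_gt0.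
have M0 : 0 <= M.
  apply: le_trans (norm1_ge0 (h 0)) (hM 0 _).
  by rewrite /circle /= in_itv /= oppr_le0 !pi_ge0.
have hr l : circle l -> `|Re (h l)| <= M.
  by move=> cl; apply: le_trans (hM l cl); rewrite lerDl.
have hi l : circle l -> `|Im (h l)| <= M.
  by move=> cl; apply: le_trans (hM l cl); rewrite lerDr.
have [u [cu uM ue]] := continuous_approx M0 mr hr e2.
have [v [cv vM ve]] := continuous_approx M0 mi hi e2.
exists (fun l => u l +i* v l); split.
- by split.
- by move=> l; rewrite /norm1 /=; have := uM l; have := vM l; lra.
have iu : circle_integrable (fun l => `|Re (h l) - u l|).
  apply: circle_integrable_norm; apply: circle_integrableB.
    exact: circle_integrable_bounded mr hr.
  exact: continuous_circle_integrable.
have iv : circle_integrable (fun l => `|Im (h l) - v l|).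
  apply: circle_integrable_norm; apply: circle_integrableB.
    exact: circle_integrable_bounded mi hi.
  exact: continuous_circle_integrable.
under eq_rmean do rewrite /norm1 complex_ReD complex_ImD complex_ReN complex_ImN.
by rewrite rmeanD //=; lra.
Qed.

(** Subtract from a continuous approximation [g] its own Fourier part of orders 0, ..., N. As the
    coefficients of [h] vanish there, those of [g] are the coefficients of g - h up to sign, hence
    as small as the mean error. [M'] is fixed before [e]. *)
Lemma vanishing_coef_approx (N : nat) h M : cmeasurable h ->
  (forall l, circle l -> norm1 (h l) <= M) ->
  (forall k : 'I_N.+1, cmean (fun l => h l * cexp (- k%:Z) l) = 0) ->
  exists M' : R, forall e : R, 0 < e -> exists g, [/\ ccontinuous g,
    (forall l, circle l -> norm1 (g l) <= M'),
    (forall k : 'I_N.+1, cmean (fun l => g l * cexp (- k%:Z) l) = 0) &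
    rmean (fun l => norm1 (h l - g l)) < e].
Proof.
move=> mh hM h0.
(* 2 M bounds [g]; each of the N + 1 corrections has a coefficient of size at most 2 (2 M) and an
   exponential of [norm1] at most 2. *)
exists (2 * M + \sum_(k < N.+1) 2 * (2 * M) * 2) => e e0.
(* A mean error [eta] of [g] makes each coefficient at most 2 [eta], hence each correction at most 4
   [eta]: the total is [eta * K]. *)
pose K : R := 1 + \sum_(k < N.+1) 4.
have K0 : 0 < K by rewrite ltr_pwDl // sumr_ge0.
have [g [cg gM ge]] := ccontinuous_approx mh hM (divr_gt0 e0 K0).
have mg := ccontinuous_measurable cg.
pose c (k : 'I_N.+1) := cmean (fun l => g l * cexp (- k%:Z) l).
pose s l := \sum_(k < N.+1) c k * cexp k%:Z l.
have gMc l : circle l -> norm1 (g l) <= 2 * M by move=> _; exact: gM.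
have cM k : norm1 (c k) <= 2 * (2 * M).
  apply: le_trans (norm1_coef _ mg gMc) _; rewrite ler_pM2l //.
  rewrite -[leRHS]rmean_cst; apply: le_rmean => //.
    exact: circle_integrable_norm1 mg gMc.
  exact: circle_integrable_cst.
have mhg : cmeasurable (fun l => h l - g l) by exact: cmeasurableB.
have hgM l : circle l -> norm1 (h l - g l) <= M + 2 * M.
  by move=> cl; apply: le_trans (norm1B _ _) _; rewrite lerD ?hM ?gM.
set eta := rmean _ in ge.
have ceta k : norm1 (c k) <= 2 * eta.
  have := norm1_coef (- k%:Z) mhg hgM.
  under eq_cmean do rewrite mulrBl.
  rewrite cmeanB ?h0 ?sub0r ?norm1N //.
    exact: cintegrable_coef mh hM.
  exact: cintegrable_coef mg gMc.
have cs : ccontinuous s.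
  apply: ccontinuous_sum => k; apply: ccontinuousM.
    exact: ccontinuous_cst.
  exact: ccontinuous_cexp.
have sB b : (forall k, norm1 (c k) <= b) ->
    forall l, norm1 (s l) <= \sum_(k < N.+1) b * 2.
  move=> cb l; apply: le_trans (norm1_sum _ _) _; apply: ler_sum => k _.
  apply: le_trans (norm1M _ _) _.
  by apply: ler_pM; rewrite ?norm1_ge0 ?norm1_cexp.
have cgs : ccontinuous (fun l => g l - s l).
  under eq_fun do rewrite -[s _]opprK opprK -mulN1r.
  apply: ccontinuousD => //; apply: ccontinuousM => //.
  exact: ccontinuous_cst.
exists (fun l => g l - s l); split => //.
- move=> l cl; apply: le_trans (norm1B _ _) _.
  by apply: lerD; [exact: gM|exact: sB].
- move=> k; under eq_cmean do rewrite mulrBl.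
  have cexpI (j m : int) : cintegrable (fun l => cexp j l * cexp m l : R[i]).
    apply: ccontinuous_integrable; apply: ccontinuousM;
    exact: ccontinuous_cexp.
  rewrite cmeanB; [|exact: cintegrable_coef mg gMc|]; last first.
    apply: ccontinuous_integrable; apply: ccontinuousM => //.
    exact: ccontinuous_cexp.
  under [X in _ - X]eq_cmean do rewrite /s big_distrl /=.
  under [X in _ - X]eq_cmean do under eq_bigr do rewrite -mulrA.
  rewrite cmean_sum => [|j]; last exact: cintegrableZ.
  rewrite (bigD1 k) //= cmeanZ // big1 => [|j jk].
    under [X in _ * X]eq_cmean do rewrite -cexpD subrr.
    by rewrite cmean_cexp eqxx mulr1 addr0 subrr.
  rewrite cmeanZ //; under eq_cmean do rewrite -cexpD.
  rewrite cmean_cexp subr_eq0 eqz_nat; case: eqP => [jk'|_]; last first.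
    by rewrite mulr0.
  by case/eqP: jk; exact: val_inj.
- have ihg : circle_integrable (fun l => norm1 (h l - g l)).
    exact: circle_integrable_norm1 mhg hgM.
  apply: (@le_lt_trans _ _ (eta * K)); last by rewrite -ltr_pdivlMr.
  have -> : eta * K = rmean (fun l => norm1 (h l - g l) +
      \sum_(k < N.+1) 2 * eta * 2).
    rewrite rmeanD // ?rmean_cst; last exact: circle_integrable_cst.
    rewrite mulrDr mulr1 mulr_sumr; congr (_ + _).
    by apply: eq_bigr => k _; ring.
  apply: le_rmean.
  + apply: cintegrable_norm1.
    under eq_fun do rewrite opprB addrA addrAC.
    apply: cintegrableD; first exact: cintegrable_bounded mhg hgM.
    exact: ccontinuous_integrable.
  + by apply: circle_integrableD => //; exact: circle_integrable_cst.
  + move=> l cl; rewrite opprB addrA addrAC.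
    by apply: le_trans (norm1D _ _) _; rewrite lerD2l sB.
Qed.

Lemma observed_span_approx (N : nat) h M : cmeasurable h ->
  (forall l, circle l -> norm1 (h l) <= M) ->
  (forall k : 'I_N.+1, cmean (fun l => h l * cexp (- k%:Z) l) = 0) ->
  exists M' : R, forall e : R, 0 < e -> exists q, [/\ observed_span N q,
    cmeasurable q, (forall l, circle l -> norm1 (q l) <= M') &
    rmean (fun l => norm1 (h l - q l)) < e].
Proof.
move=> mh hM h0; have [M' H] := vanishing_coef_approx mh hM h0.
exists M' => e e0; have e2 : 0 < e / 2 by rewrite divr_gt0.
have [g [cg gM g0 ge]] := H _ e2.
have mg := ccontinuous_measurable cg.
have [n ne] := fejer_mean_cvg cg gM e2.
have cq := ccontinuous_fejer_mean n cg.
have mq := ccontinuous_measurable cq.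
have qM l : circle l -> norm1 (fejer_mean n g l) <= M'.
  by move=> _; exact: norm1_fejer_mean.
exists (fejer_mean n g); split => //.
- have ig m := cintegrable_coef m mg gM.
  have -> := funext (fun x => fejer_mean_sum n (ccontinuous_integrable cg) x ig).
  (* Negative frequencies are admissible; at k = 0, ..., N the coefficient contains the vanishing
     mean of g e^{-ik}. *)
  apply: observed_span_sum => p /andP[]; case: (fejer_freq p) => // k _ kN.
  have kN' : (k < N.+1)%N by rewrite ltnS.
  by have /= -> := g0 (Ordinal kN'); rewrite mulr0.
- have i1 : circle_integrable (fun l => norm1 (h l - g l)).
    apply: cintegrable_norm1; apply: (cintegrable_bounded (M := M + M')).
      exact: cmeasurableB.
    by move=> l cl; apply: le_trans (norm1B _ _) _; rewrite lerD ?hM ?gM.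
  have i2 : circle_integrable (fun l => norm1 (fejer_mean n g l - g l)).
    apply: cintegrable_norm1; apply: (cintegrable_bounded (M := M' + M')).
      exact: cmeasurableB.
    by move=> l cl; apply: le_trans (norm1B _ _) _; rewrite lerD ?qM ?gM.
  apply: (@le_lt_trans _ _ (rmean (fun l => norm1 (h l - g l) +
      norm1 (fejer_mean n g l - g l)))); last by rewrite rmeanD //; lra.
  apply: le_rmean.
  + apply: cintegrable_norm1; apply: (cintegrable_bounded (M := M + M')).
      exact: cmeasurableB.
    by move=> l cl; apply: le_trans (norm1B _ _) _; rewrite lerD ?hM ?qM.
  + exact: circle_integrableD.
  + move=> l cl.
    have -> : h l - fejer_mean n g l = h l - g l - (fejer_mean n g l - g l).
      by rewrite opprB addrA subrK.
    exact: norm1B.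
Qed.

Lemma measurable_normc_sqr h : cmeasurable h ->
  measurable_fun circle (fun l => normc (h l) ^+ 2).
Proof.
move=> [mr mi]; under eq_fun do rewrite normc_sqr.
by apply: measurable_funD; exact: measurable_funX.
Qed.

Lemma circle_integrable_sq_weight f h M : circle_integrable f ->
  (forall l, circle l -> 0 <= f l) -> cmeasurable h ->
  (forall l, circle l -> norm1 (h l) <= M) ->
  circle_integrable (fun l => normc (h l) ^+ 2 * f l).
Proof.
move=> i_f f0 mh hM.
apply: (circle_integrable_le _ (circle_integrableZ (M ^+ 2) i_f)).
  apply: measurable_funM; first exact: measurable_normc_sqr.
  exact: circle_integrable_measurable.
move=> l cl; rewrite ger0_norm; last by rewrite mulr_ge0 ?sqr_ge0 ?f0.
apply: ler_wpM2r; first exact: f0.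
apply: le_trans (normc_sqr_le _) _.
have := hM l cl; have := norm1_ge0 (h l); nra.
Qed.

Lemma sqnormE f h : circle_integrable (fun l => normc (h l) ^+ 2 * f l) ->
  sqnorm f h = (rmean (fun l => normc (h l) ^+ 2 * f l))%:E.
Proof. exact: emean_rmean. Qed.

(** With D = [norm1 (h - q)] bounded uniformly in [q], the product D^2 f is split into a small
    multiple of f^2 and a large multiple of D; the mean of the latter is then made small by the
    choice of [q]. *)
Lemma L2obs_bounded (N : nat) f h M : (forall l, circle l -> 0 <= f l) ->
  circle_integrable f -> circle_integrable (fun l => f l ^+ 2) ->
  cmeasurable h -> (forall l, circle l -> norm1 (h l) <= M) ->
  (forall k : 'I_N.+1, cmean (fun l => h l * cexp (- k%:Z) l) = 0) ->
  L2obs N f h.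
Proof.
move=> f0 i_f if2 mh hM h0; split => //.
  by rewrite sqnormE ?ltry //; exact: circle_integrable_sq_weight i_f f0 mh hM.
move=> e e0; have [M' H] := observed_span_approx mh hM h0.
pose B := `|M + M'| + 1; have B0 : 0 < B by rewrite ltr_pwDr.
pose S := rmean (fun l => f l ^+ 2).
have S0 : 0 <= S by apply: rmean_ge0 => l _; exact: sqr_ge0.
(* [d] makes d / 2 times the mean of f^2 at most e / 2, the added 1 covering the case S = 0; [c] is
   the factor that the splitting leaves in front of D, so a mean error below e / (2 c) contributes
   less than the other half. *)
pose d := e / (S + 1); have d0 : 0 < d by rewrite divr_gt0 // ltr_pwDr.
pose c := B ^+ 3 / (2 * d).
have c0 : 0 < c.
  by apply: divr_gt0; [exact: exprn_gt0|exact: mulr_gt0].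
have [|q [oq mq qM hq]] := H (e / (2 * c)); first exact/divr_gt0/mulr_gt0.
exists q => //.
have mD : cmeasurable (fun l => h l - q l) by exact: cmeasurableB.
have DB l : circle l -> norm1 (h l - q l) <= B.
  move=> cl; apply: le_trans (norm1B _ _) _; have := hM l cl; have := qM l cl.
  by have := ler_norm (M + M'); rewrite /B; lra.
have iD := circle_integrable_norm1 mD DB.
have iDf := circle_integrable_sq_weight i_f f0 mD DB.
rewrite sqnormE // lte_fin.
apply: (@le_lt_trans _ _ (rmean (fun l => d / 2 * f l ^+ 2 +
    c * norm1 (h l - q l)))).
  apply: le_rmean => //.
    by apply: circle_integrableD; exact: circle_integrableZ.
  move=> l cl; set D := norm1 (h l - q l).
  have D0 : 0 <= D := norm1_ge0 _; have DBl : D <= B := DB l cl.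
  apply: (@le_trans _ _ (D ^+ 2 * f l)).
    by rewrite ler_wpM2r ?f0 // normc_sqr_le.
  have -> : c * D = B ^+ 3 * D / (2 * d) by rewrite /c mulrAC.
  (* AM-GM for [d f^2] and [D^4 / d], and [D^4 <= B^3 D] *)
  have D4 : D ^+ 4 <= B ^+ 3 * D.
    by rewrite exprSr ler_wpM2r // ler_pXn2r ?nnegrE // ltW.
  apply: (@le_trans _ _ (d / 2 * f l ^+ 2 + D ^+ 4 / (2 * d))).
    rewrite -subr_ge0.
    have -> : d / 2 * f l ^+ 2 + D ^+ 4 / (2 * d) - D ^+ 2 * f l =
      (d * f l - D ^+ 2) ^+ 2 / (2 * d) by field; rewrite gt_eqF.
    by rewrite divr_ge0 ?sqr_ge0 // mulr_ge0 // ltW.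
  by rewrite lerD2l ler_wpM2r // invr_ge0 mulr_ge0 // ltW.
rewrite rmeanD ?rmeanZ //; try exact: circle_integrableZ.
rewrite -/S.
have : c * rmean (fun l => norm1 (h l - q l)) < e / 2.
  rewrite mulrC -ltr_pdivlMr //; apply: lt_le_trans hq _.
  by rewrite invfM mulrA.
have : d / 2 * S <= e / 2.
  rewrite mulrAC ler_pM2r ?invr_gt0 // /d mulrAC ler_pdivrMr ?ltr_pwDr //.
  by rewrite mulrDr mulr1 lerDl ltW.
by lra.
Qed.

End ObservedApproximation.

(** * Toeplitz matrices *)

Section Toeplitz.
Context {R : realType}.
Local Notation mu := (@lebesgue_measure R).
Local Notation Re := (@complex.Re R).
Local Notation Im := (@complex.Im R).
Implicit Types (g h : R -> R[i]) (z : R[i]) (w f : R -> R).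

(** A general weight covers B_N, where it is the inverse density, and the identity matrix, where it
    is 1; the latter turns weighted statements into Parseval's identity. *)
Definition toeplitz (N : nat) w : 'M[R[i]]_N.+1 :=
  \matrix_(k, j) cmean (fun l => (w l)%:C * cexp (- (k%:Z - j%:Z)) l).

Lemma ccontinuous_trigpoly (N : nat) (x : 'cV[R[i]]_N.+1) :
  ccontinuous (trigpoly x).
Proof.
apply: ccontinuous_sum => j; apply: ccontinuousM; last exact: ccontinuous_cexp.
exact: ccontinuous_cst.
Qed.

Lemma norm1_sum_cexp (I : Type) (s : seq I) (c : I -> R[i]) (m : I -> int) l :
  norm1 (\sum_(i <- s) c i * cexp (m i) l) <= \sum_(i <- s) norm1 (c i) * 2.
Proof.
apply: le_trans (norm1_sum _ _) _; apply: ler_sum => i _.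
by apply: le_trans (norm1M _ _) _; rewrite ler_wpM2l ?norm1_ge0 ?norm1_cexp.
Qed.

Lemma norm1_trigpoly (N : nat) (x : 'cV[R[i]]_N.+1) l :
  norm1 (trigpoly x l) <= \sum_j norm1 (x j 0) * 2.
Proof. exact: norm1_sum_cexp. Qed.

Lemma cintegrable_weight_cexp w k : circle_integrable w ->
  cintegrable (fun l => (w l)%:C * cexp k l).
Proof.
move=> iw; apply: (cintegrable_weight iw); first exact: cmeasurable_cexp.
by move=> l _; exact: norm1_cexp.
Qed.

Lemma toeplitz_coef (N : nat) w (x : 'cV[R[i]]_N.+1) (k : 'I_N.+1) :
  circle_integrable w ->
  cmean (fun l => (w l)%:C * (trigpoly x l * cexp (- k%:Z) l)) =
  (toeplitz N w *m x) k 0.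
Proof.
move=> iw; have E l : (w l)%:C * (trigpoly x l * cexp (- k%:Z) l) =
    \sum_j x j 0 * ((w l)%:C * cexp (- (k%:Z - j%:Z)) l).
  rewrite /trigpoly big_distrl big_distrr /=; apply: eq_bigr => j _.
  by rewrite opprB cexpD; ring.
rewrite (eq_cmean E) cmean_sum => [|j]; last first.
  by apply: cintegrableZ; exact: cintegrable_weight_cexp.
rewrite mxE; apply: eq_bigr => j _.
by rewrite cmeanZ ?mxE 1?mulrC //; exact: cintegrable_weight_cexp.
Qed.

Lemma toeplitz_gram (N : nat) w (x y : 'cV[R[i]]_N.+1) :
  circle_integrable w ->
  cmean (fun l => (w l)%:C * (trigpoly x l * (trigpoly y l)^*)) =
  cdot (toeplitz N w *m x) y.
Proof.
move=> iw; have E l : (w l)%:C * (trigpoly x l * (trigpoly y l)^*) =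
    \sum_k (y k 0)^* * ((w l)%:C * (trigpoly x l * cexp (- k%:Z) l)).
  rewrite [in LHS]/(trigpoly y) rmorph_sum !big_distrr /=; apply: eq_bigr => k _.
  by rewrite rmorphM /= cexpN; ring.
have ik k : cintegrable (fun l => (w l)%:C * (trigpoly x l * cexp k l)).
  apply: (cintegrable_weight (M := (\sum_j norm1 (x j 0) * 2) * 2) iw).
    apply: cmeasurableM; last exact: cmeasurable_cexp.
    by apply: ccontinuous_measurable; exact: ccontinuous_trigpoly.
  move=> l _; apply: le_trans (norm1M _ _) _.
  by apply: ler_pM; rewrite ?norm1_ge0 ?norm1_trigpoly ?norm1_cexp.
rewrite (eq_cmean E) cmean_sum => [|k]; last exact: cintegrableZ.
by apply: eq_bigr => k _; rewrite cmeanZ // toeplitz_coef // mulrC.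
Qed.

Lemma toeplitz1 (N : nat) : toeplitz N (fun=> 1) = 1%:M.
Proof.
apply/matrixP => k j; rewrite !mxE; under eq_cmean do rewrite mul1r.
by rewrite cmean_cexp oppr_eq0 subr_eq0 eqz_nat.
Qed.

Lemma trigpoly_gram (N : nat) (x y : 'cV[R[i]]_N.+1) :
  cmean (fun l => trigpoly x l * (trigpoly y l)^*) = cdot x y.
Proof.
rewrite -[x in RHS]mul1mx -toeplitz1 -toeplitz_gram; last first.
  exact: circle_integrable_cst.
by apply: eq_cmean => l; rewrite mul1r.
Qed.

Lemma cdotC (N : nat) (x y : 'cV[R[i]]_N.+1) : cdot x y = (cdot y x)^*.
Proof.
rewrite /cdot rmorph_sum; apply: eq_bigr => k _ /=.
by rewrite rmorphM mulrC; congr (_ * _); rewrite [RHS]conjcK.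
Qed.

Lemma cdot_eq0 (N : nat) (x : 'cV[R[i]]_N.+1) : cdot x x = 0 -> x = 0.
Proof.
move=> /eqP; rewrite psumr_eq0 => [/allP x0|k _]; last exact: mul_conjC_ge0.
apply/matrixP => k j; rewrite mxE ord1; apply/eqP.
by rewrite -mul_conjC_eq0; exact: (x0 k (mem_index_enum _)).
Qed.

Lemma circle_integrable_sq_trigpoly (N : nat) w (x : 'cV[R[i]]_N.+1) :
  circle_integrable w -> (forall l, circle l -> 0 <= w l) ->
  circle_integrable (fun l => normc (trigpoly x l) ^+ 2 * w l).
Proof.
move=> iw w0; apply: (circle_integrable_sq_weight iw w0).
  by apply: ccontinuous_measurable; exact: ccontinuous_trigpoly.
by move=> l _; exact: norm1_trigpoly.
Qed.

Lemma toeplitz_quad (N : nat) w (x : 'cV[R[i]]_N.+1) : circle_integrable w ->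
  cdot (toeplitz N w *m x) x =
  (rmean (fun l => normc (trigpoly x l) ^+ 2 * w l))%:C.
Proof.
move=> iw; rewrite -toeplitz_gram // cmeanE; congr Complex.
  by apply: eq_rmean => l; rewrite /comp -normc_sqrJ -rmorphM mulrC.
rewrite -[RHS](@rmean_cst R); apply: eq_rmean => l.
by rewrite /comp -normc_sqrJ -rmorphM.
Qed.

(** A kernel vector gives a polynomial whose squared modulus has [w]-weighted mean 0, so it vanishes
    almost everywhere because w > 0 there; by Parseval its coefficients are 0. *)
Lemma toeplitz_unit (N : nat) w : circle_integrable w ->
  (forall l, circle l -> 0 <= w l) -> ae_circle (fun l => 0 < w l) ->
  toeplitz N w \in unitmx.
Proof.
move=> iw w0 wp; rewrite unitmxE unitfE -det_tr; apply/det0P => -[v v0 vB].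
have Bv : toeplitz N w *m v^T = 0 by rewrite -[LHS]trmxK trmx_mul trmxK vB trmx0.
have := toeplitz_quad v^T iw; rewrite Bv /cdot big1 => [|k _]; last first.
  by rewrite mxE mul0r.
move=> /esym/(congr1 Re) /= q0.
have iq := circle_integrable_sq_trigpoly v^T iw w0.
have i1 := circle_integrable_sq_trigpoly v^T (circle_integrable_cst 1)
  (fun _ _ => ler01).
have /cdot_eq0/(congr1 trmx) : cdot v^T v^T = 0.
  rewrite -[X in cdot X]mul1mx -toeplitz1 toeplitz_quad; last first.
    exact: circle_integrable_cst.
  rewrite (_ : rmean _ = 0) // -[RHS](@rmean_cst R).
  apply: eq_rmean_ae; [exact: circle_integrable_measurable|exact: measurable_cst|].
  have := rmean_eq0 iq (fun l cl => mulr_ge0 (sqr_ge0 _) (w0 l cl)) q0.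
  apply: ae_circleS2 wp => l cl wl /eqP.
  by rewrite mulf_eq0 (gt_eqF wl) orbF mulr1 => /eqP.
by rewrite trmxK trmx0 => /eqP; rewrite (negbTE v0).
Qed.

Lemma measurable_inv_ge0 f : measurable_fun circle f ->
  (forall l, circle l -> 0 <= f l) -> measurable_fun circle (fun l => (f l)^-1).
Proof.
(* The real power -1 is measurable and agrees with inversion on nonnegative numbers, also at 0,
   where both are 0. *)
move=> mf f0; apply: (eq_measurable_fun (fun l => f l `^ (-1))).
  by move=> l /set_mem cl; rewrite powR_inv1 ?f0.
exact: (measurableT_comp (measurable_powR (-1)) mf).
Qed.

Lemma measurable_inve f : measurable_fun circle f ->
  (forall l, circle l -> 0 <= f l) ->
  measurable_fun circle (fun l => ((f l)%:E^-1)%E).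
Proof.
move=> mf f0; under eq_fun do rewrite inver.
have mb : measurable_fun circle (fun l => f l == 0).
  by apply: (measurable_fun_eqr mf); exact: measurable_cst.
apply: measurable_fun_if => //; first exact: measurable_circle.
apply/measurable_EFinP; apply: measurable_funS (measurable_inv_ge0 mf f0) => //.
exact: measurable_circle.
Qed.

(** Passes from the extended inverse to the real one used in B_N: the extended inverse dominates it,
    and being integrable is finite almost everywhere, which removes the zeros of [f]. *)
Lemma minimal_densityP f : spectral_density f -> minimal_density f ->
  circle_integrable (fun l => (f l)^-1) /\ ae_circle (fun l => 0 < f l).
Proof.
move=> [f0 i_f] fm; have mf := circle_integrable_measurable i_f.
have minv := measurable_inv_ge0 mf f0.
have minve := measurable_inve mf f0.
have inve_ge l : circle l -> (0 <= (f l)%:E^-1)%E.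
  by move=> cl; rewrite inver; case: ifP => // _; rewrite lee_fin invr_ge0 f0.
have iinve : mu.-integrable circle (fun l => ((f l)%:E^-1)%E).
  apply/integrableP; split => //.
  rewrite (_ : (\int[mu]_(l in circle) _)%E =
    (\int[mu]_(l in circle) ((f l)%:E^-1))%E) //.
  by apply: eq_integral => l /set_mem cl; rewrite gee0_abs ?inve_ge.
split.
  apply: le_integrable iinve => //; first exact: measurable_circle.
    exact/measurable_EFinP.
  move=> l cl; rewrite inver /=; case: ifP => [/eqP ->|//].
  by rewrite invr0 normr0 leey.
have fin_inve : ae_circle (fun l => ((f l)%:E^-1)%E \is a fin_num).
  by apply: integrable_ae iinve; exact: measurable_circle.
apply: ae_circleS fin_inve => l cl; rewrite inver; case: ifPn => // fl0 _.
by rewrite lt0r fl0 f0.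
Qed.

Lemma minimal_densityZ (c : R) f : 1 <= c -> spectral_density f ->
  minimal_density f -> minimal_density (fun l => c * f l).
Proof.
move=> c1 sf fm; have [iinv fp] := minimal_densityP sf fm; case: sf => f0 i_f.
have c0 : 0 < c by apply: lt_le_trans c1.
have ic : circle_integrable (fun l => c^-1 * (f l)^-1).
  exact: circle_integrableZ.
apply: le_lt_trans (_ : (\int[mu]_(l in circle) `|(c^-1 * (f l)^-1)%:E| < +oo)%E).
  have mf := circle_integrable_measurable i_f.
  apply: ae_ge0_le_integral.
  - exact: measurable_circle.
  - by move=> l cl; rewrite inver; case: ifP => // _;
      rewrite lee_fin invr_ge0 mulr_ge0 ?f0 // ltW.
  - apply: measurable_inve; last by move=> l cl; rewrite mulr_ge0 ?f0 // ltW.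
    exact: measurable_funM.
  - by [].
  - apply: measurableT_comp => //; apply/measurable_EFinP.
    exact: circle_integrable_measurable.
  - apply: ae_circleS fp => l cl fl.
    by rewrite inver mulf_eq0 !gt_eqF //= lee_fin invfM ler_norm.
by case/integrableP : ic.
Qed.

Lemma toeplitzZ (N : nat) (c : R) w : circle_integrable w ->
  toeplitz N (fun l => c * w l) = c%:C *: toeplitz N w.
Proof.
move=> iw; apply/matrixP => k j; rewrite !mxE -cmeanZ; last first.
  exact: cintegrable_weight_cexp.
by apply: eq_cmean => l; rewrite rmorphM /= mulrA.
Qed.

Lemma BmxE (N : nat) f : Bmx N f = toeplitz N (fun l => (f l)^-1).
Proof. by []. Qed.

Section Minimal.
Variables (N : nat) (a : 'cV[R[i]]_N.+1) (f : R -> R).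
Hypotheses (sf : spectral_density f) (mf : minimal_density f).

Let iinv : circle_integrable (fun l => (f l)^-1).
Proof. exact: (minimal_densityP sf mf).1. Qed.

Let inv_ge0 l : circle l -> 0 <= (f l)^-1.
Proof. by move=> cl; rewrite invr_ge0; exact: sf.1. Qed.

(** The common real value of the quadratic form [quad_error] and of the error of [h_formula] under
    [f]. *)
Definition minimal_error :=
  rmean (fun l => normc (C_N a f l) ^+ 2 * (f l)^-1).

Lemma Bmx_unit : Bmx N f \in unitmx.
Proof.
apply: toeplitz_unit => //.
by apply: ae_circleS (minimal_densityP sf mf).2 => l _; rewrite invr_gt0.
Qed.

Lemma minimal_error_integrable :
  circle_integrable (fun l => normc (C_N a f l) ^+ 2 * (f l)^-1).
Proof. exact: circle_integrable_sq_trigpoly. Qed.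

Lemma minimal_error_ge0 : 0 <= minimal_error.
Proof.
by apply: rmean_ge0 => l cl; rewrite mulr_ge0 ?sqr_ge0 ?inv_ge0.
Qed.

(** Writing [a] as B_N x with x the coefficient vector of C, the form is the conjugate of the real
    number given by x in [toeplitz_quad]. Realness matters because the order on complex numbers
    compares only those with equal imaginary parts. *)
Lemma quad_errorE : quad_error a f = minimal_error%:C.
Proof.
rewrite /quad_error -[X in cdot _ X](mulKVmx Bmx_unit) cdotC toeplitz_quad //.
exact: conjc_real.
Qed.

(** The inverse density scales by 1 / c, hence so does B_N, and its inverse by c. *)
Lemma quad_errorZ (c : R) : 0 < c ->
  quad_error a (fun l => c * f l) = c%:C * quad_error a f.
Proof.
move=> c0; have BZ : Bmx N (fun l => c * f l) = (c^-1)%:C *: Bmx N f.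
  transitivity (toeplitz N (fun l => c^-1 * (f l)^-1)); last exact: toeplitzZ.
  by rewrite BmxE; congr toeplitz; apply/funext => l; rewrite invfM.
rewrite /quad_error BZ.
have cC0 : (c^-1)%:C \is a GRing.unit.
  by rewrite unitfE fmorph_eq0 invr_eq0 gt_eqF.
rewrite invmxZ ?unitmxZ ?Bmx_unit // fmorphV invrK -scalemxAl.
rewrite /cdot mulr_sumr; apply: eq_bigr => k _.
by rewrite mxE mulrA.
Qed.

Lemma h_formula_coef (k : 'I_N.+1) :
  cmean (fun l => h_formula a f l * cexp (- k%:Z) l) = 0.
Proof.
have cc (x : 'cV[R[i]]_N.+1) : ccontinuous (fun l => trigpoly (N := N) x l * cexp (- k%:Z) l).
  apply: ccontinuousM; first exact: ccontinuous_trigpoly.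
  exact: ccontinuous_cexp.
have ica : cintegrable (fun l => (f l)^-1%:C * (C_N a f l * cexp (- k%:Z) l)).
  apply: (cintegrable_weight (M := (\sum_j norm1 ((invmx (Bmx N f) *m a) j 0) * 2) * 2) iinv).
    by apply: ccontinuous_measurable; exact: cc.
  move=> l _; apply: le_trans (norm1M _ _) _.
  by apply: ler_pM; rewrite ?norm1_ge0 ?norm1_trigpoly ?norm1_cexp.
under eq_cmean do rewrite /h_formula mulrBl (mulrC (C_N _ _ _)) -mulrA.
rewrite cmeanB //; last exact: ccontinuous_integrable.
rewrite toeplitz_coef // -BmxE mulKVmx ?Bmx_unit //.
under eq_cmean do rewrite -[trigpoly _ _ * _]mul1r.
rewrite (toeplitz_coef (w := fun=> 1)); last exact: circle_integrable_cst.
by rewrite toeplitz1 mul1mx subrr.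
Qed.

End Minimal.

End Toeplitz.

(** * Optimality *)

Section Projection.
Context {R : realType}.
Local Notation mu := (@lebesgue_measure R).
Local Notation Re := (@complex.Re R).
Local Notation Im := (@complex.Im R).
Implicit Types (g h p : R -> R[i]) (z : R[i]) (w f : R -> R).

Lemma ccontinuousJ g : ccontinuous g -> ccontinuous (fun l => (g l)^*).
Proof.
move=> [gr gi]; split=> x.
- rewrite (_ : _ \o _ = Re \o g); first exact: gr.
  by apply/funext => l; rewrite /= complex_ReJ.
- rewrite (_ : _ \o _ = \- (Im \o g)); first by apply: cvgN; exact: gi.
  by apply/funext => l; rewrite /= complex_ImJ.
Qed.

Lemma eq_cmean_ae g h : cmeasurable g -> cmeasurable h ->
  ae_circle (fun l => g l = h l) -> cmean g = cmean h.
Proof.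
move=> [mgr mgi] [mhr mhi] gh; rewrite !cmeanE; congr Complex;
by apply: eq_rmean_ae => //; apply: ae_circleS gh => l _ /= ->.
Qed.

Lemma eq_sqnorm_ae f g h : measurable_fun circle f -> cmeasurable g ->
  cmeasurable h -> ae_circle (fun l => g l = h l) -> sqnorm f g = sqnorm f h.
Proof.
move=> mf mg mh gh; congr (_ * _)%E; apply: ae_eq_integral.
- exact: measurable_circle.
- by apply/measurable_EFinP; apply: measurable_funM => //;
    exact: measurable_normc_sqr.
- by apply/measurable_EFinP; apply: measurable_funM => //;
    exact: measurable_normc_sqr.
- by apply: ae_circleS gh => l _ /= ->.
Qed.

Lemma observed_span_bounded (N : nat) p : observed_span N p ->
  ccontinuous p /\ exists M : R, forall l, norm1 (p l) <= M.
Proof.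
move=> [s [c [_ ->]]]; split.
  apply: ccontinuous_sum => j; apply: ccontinuousM.
    exact: ccontinuous_cst.
  exact: ccontinuous_cexp.
by exists (\sum_(j <- s) norm1 (c j) * 2) => l; exact: norm1_sum_cexp.
Qed.

Lemma L2obs_ae (N : nat) f g h : measurable_fun circle f -> cmeasurable h ->
  ae_circle (fun l => g l = h l) -> L2obs N f g -> L2obs N f h.
Proof.
move=> mf mh gh [mg gfin gapp]; split => //.
  by rewrite -(eq_sqnorm_ae mf mg mh gh).
move=> e e0; have [q qo qe] := gapp e e0; exists q => //.
have [cq _] := observed_span_bounded qo.
have mq := ccontinuous_measurable cq.
rewrite -(@eq_sqnorm_ae _ (fun l => g l - q l)) //; try exact: cmeasurableB.
by apply: ae_circleS gh => l _ ->.
Qed.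

(** The residual A - h0 equals C / f, so its orthogonality to the observed span in L_2(f) is this
    unweighted statement about C, in which the frequencies are disjoint. *)
Lemma trigpoly_orth (N : nat) (x : 'cV[R[i]]_N.+1) p : observed_span N p ->
  cmean (fun l => trigpoly x l * (p l)^*) = 0.
Proof.
move=> [s [c [/allP sN ->]]].
have E l : trigpoly x l * (\sum_(j <- s) c j * cexp j l)^* =
    \sum_(j <- s) \sum_k ((c j)^* * x k 0) * cexp (k%:Z - j) l.
  rewrite rmorph_sum big_distrr /=; apply: eq_bigr => j _.
  rewrite big_distrl /=; apply: eq_bigr => k _.
  by rewrite rmorphM /= cexpD cexpN; ring.
have ik (j : int) (k : 'I_N.+1) : cintegrable
    (fun l => ((c j)^* * x k 0) * cexp (k%:Z - j) l).
  by apply: cintegrableZ; apply: ccontinuous_integrable; exact: ccontinuous_cexp.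
rewrite (eq_cmean E) cmean_sum => [|j]; last exact: cintegrable_sum.
rewrite big_seq big1 // => j js; rewrite cmean_sum // big1 // => k _.
rewrite cmeanZ ?cmean_cexp; last first.
  by apply: ccontinuous_integrable; exact: ccontinuous_cexp.
rewrite subr_eq0; case: eqP => [kj|_]; last by rewrite mulr0.
by have := sN j js; rewrite -kj lez_nat -ltnS ltn_ord.
Qed.

(** Young's inequality with a free weight: [s] can be taken small after which the second term is
    made negligible. *)
Lemma normc_sqrD_le (s : R) z z' : 0 < s ->
  normc (z + z') ^+ 2 <= (1 + s) * normc z ^+ 2 + (1 + s^-1) * normc z' ^+ 2.
Proof.
move=> s0; rewrite !normc_sqr complex_ReD complex_ImD.
have H (x y : R) : (x + y) ^+ 2 <= (1 + s) * x ^+ 2 + (1 + s^-1) * y ^+ 2.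
  rewrite -subr_ge0.
  have -> : (1 + s) * x ^+ 2 + (1 + s^-1) * y ^+ 2 - (x + y) ^+ 2 =
      (s * x - y) ^+ 2 / s by field; rewrite gt_eqF.
  by rewrite divr_ge0 ?sqr_ge0 // ltW.
have := H (Re z) (Re z'); have := H (Im z) (Im z'); lra.
Qed.

Lemma le_of_approx (k v : R) : 0 <= v -> 
  (forall s e : R, 0 < s -> 0 < e -> k <= (1 + s) * v + (1 + s^-1) * e) -> k <= v.
Proof.
move=> v0 H; rewrite leNgt; apply/negP => vk.
(* This [s] gives s v < (k - v) / 2, and [e] is then chosen so that (1 + 1 / s) e is the other half
   of k - v. *)
pose s := (k - v) / (2 * (v + 1)).
have v1 : 0 < 2 * (v + 1) by lra.
have s0 : 0 < s by rewrite divr_gt0 ?subr_gt0.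
have s1 : 0 < 1 + s^-1 by rewrite addr_gt0 ?invr_gt0.
have e0 : 0 < (k - v) / (2 * (1 + s^-1)).
  by rewrite divr_gt0 ?subr_gt0 // mulr_gt0.
have := H s _ s0 e0.
have E (t : R) : 0 < t -> t * ((k - v) / (2 * t)) = (k - v) / 2.
  by move=> t0; field; rewrite gt_eqF.
rewrite E //.
have : s * (v + 1) = (k - v) / 2 by rewrite /s; field; lra.
lra.
Qed.

Section Minimal.
Variables (N : nat) (a : 'cV[R[i]]_N.+1) (f : R -> R).
Hypotheses (sf : spectral_density f) (mf : minimal_density f).
Local Notation h0 := (h_formula a f).
Local Notation C := (C_N a f).
Local Notation kappa := (minimal_error a f).

Let f_measurable : measurable_fun circle f.
Proof. by apply: circle_integrable_measurable; exact: sf.2. Qed.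

Lemma ccontinuous_C : ccontinuous C.
Proof. exact: ccontinuous_trigpoly. Qed.

Lemma cmeasurable_h : cmeasurable h0.
Proof.
apply: cmeasurableB.
  by apply: ccontinuous_measurable; exact: ccontinuous_trigpoly.
apply: cmeasurableM; first exact/ccontinuous_measurable/ccontinuous_C.
by apply: cmeasurable_real; exact: measurable_inv_ge0 f_measurable sf.1.
Qed.

Lemma residualE l : trigpoly a l - h0 l = C l * ((f l)^-1)%:C.
Proof. by rewrite opprB addrC subrK. Qed.

Lemma Delta_h_formula : Delta a h0 f = kappa%:E.
Proof.
rewrite /Delta -[RHS]emean_rmean; last exact: minimal_error_integrable.
congr emean; apply/funext => l; rewrite residualE normcM exprMn -mulrA.
congr (_ * _)%:E; rewrite /= expr0n addr0 sqr_sqrtr ?sqr_ge0 // expr2 -mulrA.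
(* At zeros of [f] both sides vanish, since 0^-1 = 0. *)
by have [->|f0] := eqVneq (f l) 0; rewrite ?invr0 ?mul0r // mulVf ?mulr1.
Qed.

(** The squared error is bounded below by its linearization [L], affine in [p]. Its mean is 2 kappa
    - kappa, as C has inner product kappa with the polynomial of [a] and 0 with [p]. *)
Lemma minimal_error_le_span p : observed_span N p ->
  kappa <= rmean (fun l => normc (trigpoly a l - p l) ^+ 2 * f l).
Proof.
move=> po; have [cp [M pM]] := observed_span_bounded po.
have cCc u : ccontinuous u -> cintegrable (fun l => C l * (u l)^*).
  move=> cu; apply: ccontinuous_integrable.
  by apply: ccontinuousM; [exact: ccontinuous_C|exact: ccontinuousJ].
have icA := cCc _ (ccontinuous_trigpoly a).
have icp := cCc _ cp.
have EA : cmean (fun l => C l * (trigpoly a l)^*) = kappa%:C.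
  by rewrite trigpoly_gram -quad_errorE.
have Ep : cmean (fun l => C l * (p l)^*) = 0 by exact: trigpoly_orth.
have iL := minimal_error_integrable a sf mf.
pose L l := 2 * (Re (C l * (trigpoly a l)^*) - Re (C l * (p l)^*)) -
  normc (C l) ^+ 2 * (f l)^-1.
have iRe : circle_integrable
    (fun l => Re (C l * (trigpoly a l)^*) - Re (C l * (p l)^*)).
  by apply: circle_integrableB; [exact: icA.1|exact: icp.1].
have -> : kappa = rmean L.
  rewrite rmeanB ?rmeanZ ?rmeanB //; try exact: circle_integrableZ.
  - move/(congr1 Re): EA => /= EA; move/(congr1 Re): Ep => /= Ep.
    by rewrite [X in 2 * (X - _)]EA [X in 2 * (_ - X)]Ep /minimal_error; ring.
  - exact: icA.1.
  - exact: icp.1.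
apply: le_rmean_ae.
- by apply: circle_integrableB => //; exact: circle_integrableZ.
- apply: (circle_integrable_sq_weight (M := \sum_j norm1 (a j 0) * 2 + M) sf.2 sf.1).
    apply: ccontinuous_measurable.
    under eq_fun do rewrite -[p _]opprK opprK -mulN1r.
    apply: ccontinuousD; first exact: ccontinuous_trigpoly.
    by apply: ccontinuousM => //; exact: ccontinuous_cst.
  move=> l _; apply: le_trans (norm1B _ _) _.
  by rewrite lerD ?norm1_trigpoly ?pM.
- apply: ae_circleS (minimal_densityP sf mf).2 => l cl fl.
  (* [|u|^2 f >= 2 Re (C u^* ) - |C|^2 / f], from [|u f - C|^2 / f >= 0] *)
  rewrite /L; set A := trigpoly a l; set u := A - p l.
  have -> : Re (C l * A^*) - Re (C l * (p l)^*) =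
      Re (C l) * Re u + Im (C l) * Im u.
    rewrite /u !complex_ReM !complex_ReJ !complex_ImJ complex_ReD complex_ImD.
    by rewrite complex_ReN complex_ImN; ring.
  rewrite !normc_sqr -subr_ge0.
  rewrite (_ : _ - _ = ((Re u * f l - Re (C l)) ^+ 2 +
    (Im u * f l - Im (C l)) ^+ 2) / f l); last by field; rewrite gt_eqF.
  by rewrite divr_ge0 ?addr_ge0 ?sqr_ge0 // ltW.
Qed.

(** Extends the bound from the span to its closure: replacing [p] by [g] costs an arbitrarily small
    factor and an arbitrarily small term. *)
Lemma minimal_error_le g : L2obs N f g -> (kappa%:E <= Delta a g f)%E.
Proof.
move=> [mg gfin gapp].
have [->|Dfin] := eqVneq (Delta a g f) +oo%E; first exact: leey.
have mA := ccontinuous_measurable (ccontinuous_trigpoly a).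
have mAg : cmeasurable (fun l => trigpoly a l - g l) by exact: cmeasurableB.
have sq_int u : cmeasurable u -> (sqnorm f u < +oo)%E ->
    circle_integrable (fun l => normc (u l) ^+ 2 * f l).
  move=> mu_; apply: emean_lty.
    by apply: measurable_funM => //; exact: measurable_normc_sqr.
  by move=> l cl; rewrite mulr_ge0 ?sqr_ge0 ?sf.1.
have iAg : circle_integrable (fun l => normc (trigpoly a l - g l) ^+ 2 * f l).
  by apply: sq_int => //; rewrite ltey.
rewrite /Delta sqnormE // lee_fin; apply: le_of_approx.
  by apply: rmean_ge0 => l cl; rewrite mulr_ge0 ?sqr_ge0 ?sf.1.
move=> s e s0 e0; have [p po pe] := gapp e e0.
have [cp _] := observed_span_bounded po; have mp := ccontinuous_measurable cp.
have mgp : cmeasurable (fun l => g l - p l) by exact: cmeasurableB.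
have igp : circle_integrable (fun l => normc (g l - p l) ^+ 2 * f l).
  by apply: sq_int => //; apply: lt_trans pe _; rewrite ltry.
rewrite sqnormE // lte_fin in pe.
have s1 : 0 <= 1 + s^-1 by rewrite addr_ge0 // invr_ge0 ltW.
apply: le_trans (minimal_error_le_span po) _.
apply: (@le_trans _ _ (rmean (fun l =>
    (1 + s) * (normc (trigpoly a l - g l) ^+ 2 * f l) +
    (1 + s^-1) * (normc (g l - p l) ^+ 2 * f l)))); last first.
  rewrite rmeanD ?rmeanZ //; try exact: circle_integrableZ.
  by rewrite lerD2l ler_wpM2l // ltW.
have ibig : circle_integrable (fun l =>
    (1 + s) * (normc (trigpoly a l - g l) ^+ 2 * f l) +
    (1 + s^-1) * (normc (g l - p l) ^+ 2 * f l)).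
  by apply: circle_integrableD; exact: circle_integrableZ.
have ptw l : circle l -> normc (trigpoly a l - p l) ^+ 2 * f l <=
    (1 + s) * (normc (trigpoly a l - g l) ^+ 2 * f l) +
    (1 + s^-1) * (normc (g l - p l) ^+ 2 * f l).
  move=> cl; rewrite mulrA (mulrA (1 + s^-1)) -mulrDl ler_wpM2r ?sf.1 //.
  rewrite (_ : trigpoly a l - p l = (trigpoly a l - g l) + (g l - p l)).
    exact: normc_sqrD_le.
  by rewrite addrA subrK.
apply: le_rmean => //; apply: (circle_integrable_le _ ibig).
  apply: measurable_funM => //; apply: measurable_normc_sqr.
  exact: cmeasurableB.
by move=> l cl; rewrite ger0_norm ?ptw // mulr_ge0 ?sqr_ge0 ?sf.1.
Qed.

(** The bound on h0 holds only almost everywhere, so the real and imaginary parts are truncated to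
    get a version bounded everywhere, and membership is carried back. Minimality concerns [f] alone;
    [f'] is merely square integrable. *)
Lemma L2obs_h_formula M f' : ae_circle (fun l => normc (h0 l) <= M) ->
  spectral_density f' -> circle_integrable (fun l => f' l ^+ 2) ->
  L2obs N f' h0.
Proof.
move=> hM [f'0 if'] if'2.
pose h' l := clip `|M| (Re (h0 l)) +i* clip `|M| (Im (h0 l)).
have [mr mi] := cmeasurable_h.
have mclip : measurable_fun setT (clip `|M|).
  by apply: continuous_measurable_fun; exact: continuous_clip.
have mh' : cmeasurable h' by split; exact: (measurableT_comp mclip).
have h'h : ae_circle (fun l => h' l = h0 l).
  apply: ae_circleS hM => l _ hl; rewrite /h' !clip_id.
  - by case: (h0 l).
  - by apply: le_trans (ler_Im_normc _) (le_trans hl (ler_norm _)).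
  - by apply: le_trans (ler_Re_normc _) (le_trans hl (ler_norm _)).
apply: (L2obs_ae _ cmeasurable_h h'h); first exact: circle_integrable_measurable.
apply: (L2obs_bounded (M := `|M| + `|M|)) => //.
  by move=> l _; rewrite /norm1 /= lerD ?norm_clip.
move=> k; rewrite -(h_formula_coef a sf mf k); apply: eq_cmean_ae.
- by apply: cmeasurableM => //; exact: cmeasurable_cexp.
- by apply: cmeasurableM; [exact: cmeasurable_h|exact: cmeasurable_cexp].
- by apply: ae_circleS h'h => l _ ->.
Qed.

End Minimal.
End Projection.

(** * The saddle point *)

Section Ball.
Context {R : realType}.
Implicit Types f g : R -> R.

(** From 0 <= f1 <= M one gets f^2 <= 2 (f - f1)^2 + 2 M^2 almost everywhere. *)
Lemma D2_square_integrable f1 eps f : spectral_density f1 ->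
  (exists M : R, ae_circle (fun l => f1 l <= M)) -> D2 f1 eps f ->
  [/\ circle_integrable (fun l => f l ^+ 2),
      circle_integrable (fun l => (f l - f1 l) ^+ 2) &
      rmean (fun l => (f l - f1 l) ^+ 2) <= eps].
Proof.
move=> [f10 if1] [M f1M] [[f0 i_f] fe].
have mf := circle_integrable_measurable i_f.
have mf1 := circle_integrable_measurable if1.
have msq : measurable_fun circle (fun l => (f l - f1 l) ^+ 2).
  by apply: measurable_funX; exact: measurable_funB.
have isq : circle_integrable (fun l => (f l - f1 l) ^+ 2).
  apply: emean_lty => // [l _|]; first exact: sqr_ge0.
  apply: le_lt_trans (ltry eps); move: fe.
  by under eq_fun do rewrite real_normK ?num_real //.
split=> //.
  have ib : circle_integrable (fun l => 2 * (f l - f1 l) ^+ 2 + 2 * M ^+ 2).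
    apply: circle_integrableD; first exact: circle_integrableZ.
    exact: circle_integrable_cst.
  apply: (circle_integrable_ae _ ib); first exact: measurable_funX.
  apply: ae_circleS f1M => l cl f1l; rewrite ger0_norm ?sqr_ge0 //.
  have f1p := f10 l cl; rewrite -subr_ge0.
  have -> : 2 * (f l - f1 l) ^+ 2 + 2 * M ^+ 2 - f l ^+ 2 =
    (f l - 2 * f1 l) ^+ 2 + 2 * ((M - f1 l) * (M + f1 l)) by ring.
  apply: addr_ge0; first exact: sqr_ge0.
  by apply: mulr_ge0 => //; apply: mulr_ge0; lra.
rewrite -lee_fin -(emean_rmean isq); move: fe.
by under eq_fun do rewrite real_normK ?num_real //.
Qed.

Lemma circle_integrable_mul f g : measurable_fun circle f ->
  measurable_fun circle g -> circle_integrable (fun l => f l ^+ 2) ->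
  circle_integrable (fun l => g l ^+ 2) -> circle_integrable (fun l => f l * g l).
Proof.
move=> mf mg if2 ig2.
apply: (circle_integrable_le _ (circle_integrableD if2 ig2)).
  exact: measurable_funM.
move=> l _; rewrite ler_norml.
have := sqr_ge0 (f l + g l); have := sqr_ge0 (f l - g l).
rewrite sqrrB sqrrD => h1 h2.
have := sqr_ge0 (f l); have := sqr_ge0 (g l); lra.
Qed.

(** Letting t tend to 0 gives eps <= E; once E = eps, a negative slope P would bring the polynomial
    below eps for small t. *)
Lemma quadratic_boundary (E P S eps : R) : E <= eps ->
  (forall t, 0 < t -> eps < E + 2 * t * P + t ^+ 2 * S) -> E = eps /\ 0 <= P.
Proof.
move=> Ee H.
(* One choice of [t] serves both halves: for t <= 1, 2 t P + t^2 S is at most t (|S| + 2 |P|), and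
   the added 1 keeps the divisor positive. *)
have bound (c : R) : 0 < c -> exists2 t : R, 0 < t & t * (`|S| + 2 * `|P| + 1) <= c /\ t <= 1.
  move=> c0; have K0 : 1 <= `|S| + 2 * `|P| + 1.
    by rewrite lerDr addr_ge0 // mulr_ge0.
  have K1 : 0 < `|S| + 2 * `|P| + 1 by apply: lt_le_trans K0.
  exists (Num.min 1 (c / (`|S| + 2 * `|P| + 1))).
    by rewrite lt_min ltr01 divr_gt0.
  by rewrite -ler_pdivlMr // !ge_min !lexx orbT.
have eE : E = eps.
  apply/eqP; rewrite eq_le Ee leNgt; apply/negP => lt.
  have [|t t0 [tc t1]] := bound (eps - E); first by rewrite subr_gt0.
  have := H t t0.
  have h1 : t ^+ 2 * S <= t * `|S|.
    rewrite expr2 -mulrA ler_pM2l //.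
    apply: le_trans (ler_norm _) _; rewrite normrM gtr0_norm //.
    by rewrite ler_piMl.
  have h2 : t * P <= t * `|P| by rewrite ler_pM2l // ler_norm.
  lra.
split=> //; rewrite leNgt; apply/negP => P0.
have [|t t0 [tc t1]] := bound (- P); first by rewrite oppr_gt0.
have := H t t0; rewrite eE.
have h1 : t ^+ 2 * S <= t * (t * `|S|).
  by rewrite expr2 -mulrA !ler_pM2l // ler_norm.
(* The quadratic term cancels at most half of 2 t P, leaving t P < 0. *)
have h2 : t * (t * `|S|) <= t * (- P).
  rewrite ler_pM2l //; apply: le_trans tc; rewrite ler_pM2l //.
  by rewrite -addrA lerDl addr_ge0 // mulr_ge0.
have : 0 < t * (- P) by rewrite mulr_gt0 // oppr_gt0.
lra.
Qed.

End Ball.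

Section Saddle.
Context {R : realType}.
Variables (N : nat) (a : 'cV[R[i]]_N.+1) (eps1 : R) (f1 f0 : R -> R) (alpha1 : R).
Hypotheses (hf1 : spectral_density f1)
  (hf1_bounded : exists M : R, ae_circle (fun l => f1 l <= M))
  (hf0 : D2 f1 eps1 f0) (hf0_minimal : minimal_density f0)
  (hC : ae_circle (fun l =>
     normc (C_N a f0 l) ^+ 2 = f0 l ^+ 2 * (f0 l - f1 l) * alpha1))
  (hmax : is_max
     [set quad_error a f | f in D2 f1 eps1 `&` minimal_density]
     (quad_error a f0)).
Local Notation kappa := (minimal_error a f0).

Let sf0 : spectral_density f0 := hf0.1.
Let if0 : circle_integrable f0 := sf0.2.
Let if1 : circle_integrable f1 := hf1.2.
Let if0sq : circle_integrable (fun l => f0 l ^+ 2).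
Proof. by have [] := D2_square_integrable hf1 hf1_bounded hf0. Qed.
Let iE : circle_integrable (fun l => (f0 l - f1 l) ^+ 2).
Proof. by have [] := D2_square_integrable hf1 hf1_bounded hf0. Qed.
Let mf0 := circle_integrable_measurable if0.
Let mD : measurable_fun circle (fun l => f0 l - f1 l).
Proof. by apply: circle_integrable_measurable; exact: circle_integrableB. Qed.
Let iP : circle_integrable (fun l => (f0 l - f1 l) * f0 l).
Proof. exact: circle_integrable_mul. Qed.

(** Ties the sign of [alpha1] to that of the mean of (f0 - f1) f0. *)
Lemma minimal_error_alpha :
  kappa = alpha1 * rmean (fun l => (f0 l - f1 l) * f0 l).
Proof.
rewrite -rmeanZ //; apply: eq_rmean_ae.
- by apply: circle_integrable_measurable; exact: minimal_error_integrable.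
- by apply: circle_integrable_measurable; exact: circle_integrableZ.
- apply: ae_circleS2 hC (minimal_densityP sf0 hf0_minimal).2 => l _ -> f0l.
  by field; rewrite gt_eqF.
Qed.

(* Dilating [f0] by [1 + t] multiplies the minimal error by [1 + t], so by
   maximality it must leave the ball. *)
Lemma dilation_leaves_ball t : 0 < kappa -> 0 < t ->
  eps1 < rmean (fun l => (f0 l - f1 l) ^+ 2) +
    2 * t * rmean (fun l => (f0 l - f1 l) * f0 l) +
    t ^+ 2 * rmean (fun l => f0 l ^+ 2).
Proof.
move=> k0 t0; rewrite ltNge; apply/negP => le_eps.
pose ft l := (1 + t) * f0 l.
have t1 : 0 < 1 + t by rewrite addr_gt0.
have sft : spectral_density ft.
  split; last exact: circle_integrableZ.
  by move=> l cl; rewrite mulr_ge0 ?(ltW t1) ?sf0.1.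
have mft : minimal_density ft.
  by apply: minimal_densityZ => //; rewrite lerDl ltW.
have Dft : D2 f1 eps1 ft.
  split=> //; have E l : `|ft l - f1 l| ^+ 2 = (f0 l - f1 l) ^+ 2 +
      2 * t * ((f0 l - f1 l) * f0 l) + t ^+ 2 * f0 l ^+ 2.
    by rewrite real_normK ?num_real // /ft; ring.
  under eq_fun do rewrite E.
  have i2 := circle_integrableD iE (circle_integrableZ (2 * t) iP).
  have i3 := circle_integrableZ (t ^+ 2) if0sq.
  rewrite emean_rmean; last exact: circle_integrableD.
  rewrite rmeanD // rmeanD //; last exact: circle_integrableZ.
  by rewrite !rmeanZ // lee_fin.
have := hmax.2 _ (ex_intro2 _ _ ft (conj Dft mft) erefl).
rewrite quad_errorZ // quad_errorE // -rmorphM lecR.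
by rewrite -subr_ge0; have : 0 < t * kappa by [exact: mulr_gt0]; lra.
Qed.

(** The error of h0 is linear in [f], with gradient [alpha1] times f0 - f1. When kappa > 0, f0 lies
    on the sphere and f0 - f1 is the outward normal there, so a nonnegative [alpha1] puts the
    maximum over the ball at f0. *)
Lemma Delta_h_le f : D2 f1 eps1 f ->
  (Delta a (h_formula a f0) f <= kappa%:E)%E.
Proof.
move=> Df; have [[f_ge0 i_f] _] := Df.
have [if2 iEf Ef] := D2_square_integrable hf1 hf1_bounded Df.
have mf := circle_integrable_measurable i_f.
have fp := (minimal_densityP sf0 hf0_minimal).2.
have mh := cmeasurable_h a sf0.
have mres : measurable_fun circle
    (fun l => normc (trigpoly a l - h_formula a f0 l) ^+ 2 * f l).
  apply: measurable_funM => //; apply: measurable_normc_sqr.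
  apply: cmeasurableB => //.
  by apply: ccontinuous_measurable; exact: ccontinuous_trigpoly.
have resE l : normc (trigpoly a l - h_formula a f0 l) ^+ 2 =
    normc (C_N a f0 l) ^+ 2 * (f0 l)^-1 ^+ 2.
  rewrite residualE normcM exprMn; congr (_ * _).
  by rewrite /= expr0n addr0 sqr_sqrtr ?sqr_ge0.
have iQ : circle_integrable (fun l => (f0 l - f1 l) * f l).
  exact: circle_integrable_mul.
have res_ae : ae_circle (fun l =>
    normc (trigpoly a l - h_formula a f0 l) ^+ 2 * f l =
    alpha1 * ((f0 l - f1 l) * f l)).
  apply: ae_circleS2 hC fp => l _ Cl f0l; rewrite resE Cl.
  by field; rewrite gt_eqF.
have iaQ := circle_integrableZ alpha1 iQ.
have ires : circle_integrable
    (fun l => normc (trigpoly a l - h_formula a f0 l) ^+ 2 * f l).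
  apply: (circle_integrable_ae mres (circle_integrable_norm iaQ)).
  by apply: ae_circleS res_ae => l _ ->.
rewrite /Delta sqnormE // lee_fin.
have k0 := minimal_error_ge0 a sf0; move: k0.
rewrite le_eqVlt => /predU1P[k0|k0].
  (* If kappa = 0, positivity of f0 makes C vanish almost everywhere, so the error of h0 is 0 under
     every [f]; the dilation argument requires kappa > 0. *)
  rewrite -k0 -[leRHS](@rmean_cst R) le_eqVlt; apply/predU1P; left.
  apply: eq_rmean_ae => //.
  have iL := minimal_error_integrable a sf0 hf0_minimal.
  have L0 l : circle l -> 0 <= normc (C_N a f0 l) ^+ 2 * (f0 l)^-1.
    by move=> cl; rewrite mulr_ge0 ?sqr_ge0 // invr_ge0 sf0.1.
  apply: ae_circleS2 (rmean_eq0 iL L0 (esym k0)) fp => l _ /eqP + f0l.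
  rewrite mulf_eq0 invr_eq0 (gt_eqF f0l) orbF resE => /eqP ->.
  by rewrite !mul0r.
have [_ _ Ef0] := D2_square_integrable hf1 hf1_bounded hf0.
have [E1 P0] := quadratic_boundary Ef0 (dilation_leaves_ball ^~ k0).
have alpha0 : 0 <= alpha1.
  rewrite leNgt; apply/negP => alpha_lt0.
  by move: k0; rewrite minimal_error_alpha ltNge nmulr_rle0 // P0.
rewrite (eq_rmean_ae mres (circle_integrable_measurable iaQ) res_ae).
rewrite rmeanZ // minimal_error_alpha ler_wpM2l //.
(* [2 (f0 - f1)(f - f0) <= (f - f1)^2 - (f0 - f1)^2] *)
have : rmean (fun l => 2 * ((f0 l - f1 l) * f l)) <=
    rmean (fun l => 2 * ((f0 l - f1 l) * f0 l) +
      ((f l - f1 l) ^+ 2 - (f0 l - f1 l) ^+ 2)).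
  apply: le_rmean; first exact: circle_integrableZ.
    apply: circle_integrableD; first exact: circle_integrableZ.
    exact: circle_integrableB.
  move=> l _; rewrite -subr_ge0.
  rewrite (_ : _ - _ = (f l - f0 l) ^+ 2) ?sqr_ge0 //; ring.
rewrite rmeanD ?rmeanB ?rmeanZ //; try exact: circle_integrableZ.
  (* f0 is on the sphere by [E1] and [f] in the ball by [Ef], so the difference of squares has
     nonpositive mean. *)
  by rewrite E1; lra.
exact: circle_integrableB.
Qed.

End Saddle.

Theorem theorem7p10 (R : realType) (N : nat) (a : 'cV[R[i]]_N.+1)
  (eps1 : R) (f1 f0 : R -> R) (alpha1 : R)
  (heps1 : 0 < eps1)
  (hf1 : spectral_density f1)
  (hf1_bounded : exists M : R, ae_circle (fun l => f1 l <= M))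
  (hf0 : D2 f1 eps1 f0)
  (hf0_minimal : minimal_density f0)
  (hh0_bounded : exists M : R,
     ae_circle (fun l => normc (h_formula a f0 l) <= M))
  (hC : ae_circle (fun l =>
     normc (C_N a f0 l) ^+ 2 = f0 l ^+ 2 * (f0 l - f1 l) * alpha1))
  (hmax : is_max
     [set quad_error a f | f in D2 f1 eps1 `&` minimal_density]
     (quad_error a f0)) :
  [/\ least_favourable a (D2 f1 eps1) f0,
      spectral_characteristic a f0 (h_formula a f0) &
      minimax_robust a (D2 f1 eps1) (h_formula a f0)].
Proof.
have sf0 := hf0.1; have [M hM] := hh0_bounded.
have hH f : D2 f1 eps1 f -> L2obs N f (h_formula a f0).
  move=> Df; have [if2 _ _] := D2_square_integrable hf1 hf1_bounded Df.
  exact: L2obs_h_formula hM Df.1 if2.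
have D0 := Delta_h_formula a sf0 hf0_minimal.
have saddle f : D2 f1 eps1 f ->
    (Delta a (h_formula a f0) f <= Delta a (h_formula a f0) f0)%E.
  by rewrite D0; exact: (Delta_h_le hf1 hf1_bounded hf0 hf0_minimal hC hmax).
have char0 : spectral_characteristic a f0 (h_formula a f0).
  split; first exact: hH.
  by move=> g og; rewrite D0; exact: minimal_error_le.
split=> //.
- split=> //; exists (h_formula a f0) => //; split.
    by exists f0, (h_formula a f0).
  (* Under [f] its own optimal [h] does no worse than h0, and h0 does no worse under [f] than under
     f0. *)
  move=> _ [f [h [Df [_ hmin] ->]]].
  exact: le_trans (hmin _ (hH f Df)) (saddle f Df).
- have max0 : max_error a (D2 f1 eps1) (h_formula a f0) =
      Delta a (h_formula a f0) f0.
    apply/eqP; rewrite eq_le; apply/andP; split.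
      by apply: ge_ereal_sup => _ [f Df <-]; exact: saddle.
    by apply: ereal_sup_ubound; exists f0.
  split=> //; split; first by exists (h_formula a f0).
  (* The worst error of any admissible [h] is at least its error under f0, where h0 is optimal. *)
  move=> _ [h hD <-]; rewrite max0.
  apply: le_trans (char0.2 _ (hD _ hf0)) _.
  by apply: ereal_sup_ubound; exists f0.
Qed.
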